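(* There are an effectively $\lambda$-measurable set $\mathcal A\subseteq 2^\omega$ and a universal Martin-Löf test $\mathcal W$ such that $\mathcal A$ is not $\mathcal W$-layerwise decidable.
   Context: Work in Cantor space $2^\omega$ with Lebesgue measure $\lambda$. For $\sigma\in 2^{<\omega}$, $[\sigma]=\{X\in 2^\omega:\sigma\prec X\}$. A sequence $(\mathcal U_i)_{i\in\omega}$ of open subsets of $2^\omega$ is uniformly effectively open if $\{\langle i,\sigma\rangle : [\sigma]\subseteq\mathcal U_i\}$ is computably enumerable. A Martin-Löf (ML) test is a uniformly effectively open sequence $(\mathcal V_i)_{i\in\omega}$ with $\lambda(\mathcal V_i)\le 2^{-i}$ for all $i$; it is universal if $\bigcap_i\mathcal V'_i\subseteq\bigcap_i\mathcal V_i$ for every ML-test $\mathcal V'$. A set $\mathcal A\subseteq 2^\omega$ is effectively $\lambda$-measurable if there are uniformly effectively open sequences $(\mathcal U_i)_{i}$ and $(\mathcal V_i)_i$ with $2^\omega\setminus\mathcal V_i\subseteq\mathcal A\subseteq\mathcal U_i$ and $\lambda(\mathcal U_i\cap\mathcal V_i)\le 2^{-i}$ for all $i$. For a universal ML-test $\mathcal W$, a set $\mathcal A$ is $\mathcal W$-layerwise semi-decidable if there is a uniformly effectively open sequence $(\mathcal U_i)_i$ with $\mathcal A\cap(2^\omega\setminus\mathcal W_i)=\mathcal U_i\cap(2^\omega\setminus\mathcal W_i)$ for all $i$, and $\mathcal W$-layerwise decidable if both $\mathcal A$ and $2^\omega\setminus\mathcal A$ are $\mathcal W$-layerwise semi-decidable.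 *)

(* Defs.v *)
From Stdlib Require Import Reals List Arith Classical ClassicalDescription.
From Coquelicot Require Import Coquelicot.
Import ListNotations.
Open Scope R_scope.

Definition cantor := nat -> bool.
Definition str := list bool.

Definition cyl (s : str) : cantor -> Prop :=
  fun X => forall k, (k < length s)%nat -> X k = nth k s false.

Definition subset_c (A B : cantor -> Prop) : Prop := forall X, A X -> B X.

Definition open_c (U : cantor -> Prop) : Prop :=
  forall X, U X -> exists s, cyl s X /\ subset_c (cyl s) U.

Fixpoint strs (n : nat) : list str :=
  match n with
  | O => [[]]
  | S n => map (cons false) (strs n) ++ map (cons true) (strs n)
  end.

Definition cnt (n : nat) (U : cantor -> Prop) : nat :=
  length (filter (fun t => if excluded_middle_informative (subset_c (cyl t) U)
                           then true else false) (strs n)).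

(** For an OPEN set U, lambda U = sup_n (#{t in 2^n : [t] ⊆ U}) / 2^n is its
    Lebesgue (uniform product) measure. Only applied to open sets below. *)
Definition lambda_open (U : cantor -> Prop) : Rbar :=
  Sup_seq (fun n => Finite (INR (cnt n U) / 2 ^ n)).

Inductive code : Type :=
| CZero : code
| CSucc : code
| CProj : nat -> code
| CComp : code -> list code -> code
| CPrec : code -> code -> code
| CMu : code -> code.

Inductive eval : code -> list nat -> nat -> Prop :=
| eZero v : eval CZero v 0
| eSucc x v : eval CSucc (x :: v) (S x)
| eProj i v : (i < length v)%nat -> eval (CProj i) v (nth i v 0%nat)
| eComp f gs v ws y : evals gs v ws -> eval f ws y -> eval (CComp f gs) v y
| ePrec0 f g v y : eval f v y -> eval (CPrec f g) (0%nat :: v) y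
| ePrecS f g n v r y :
    eval (CPrec f g) (n :: v) r -> eval g (n :: r :: v) y ->
    eval (CPrec f g) (S n :: v) y
| eMu f v n : eval f (n :: v) 0 ->
    (forall m, (m < n)%nat -> exists k, eval f (m :: v) (S k)) ->
    eval (CMu f) v n
with evals : list code -> list nat -> list nat -> Prop :=
| esNil v : evals [] v []
| esCons g gs v y ys : eval g v y -> evals gs v ys -> evals (g :: gs) v (y :: ys).

Definition ce (P : nat -> Prop) : Prop :=
  exists c : code, forall n, P n <-> exists y, eval c [n] y.

Definition pairing (i j : nat) : nat := (i + j) * (i + j + 1) / 2 + j.
Fixpoint str_code (s : str) : nat :=
  match s with
  | [] => 0
  | b :: s => 2 * str_code s + (if b then 2 else 1)
  end.
Definition enc (i : nat) (s : str) : nat := pairing i (str_code s).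

Definition unif_eff_open (U : nat -> cantor -> Prop) : Prop :=
  (forall i, open_c (U i)) /\
  ce (fun n => exists i s, n = enc i s /\ subset_c (cyl s) (U i)).

Definition ML_test (V : nat -> cantor -> Prop) : Prop :=
  unif_eff_open V /\ forall i, Rbar_le (lambda_open (V i)) (Finite (/ 2 ^ i)).

Definition bigcap_c (V : nat -> cantor -> Prop) : cantor -> Prop :=
  fun X => forall i, V i X.

Definition universal_ML_test (V : nat -> cantor -> Prop) : Prop :=
  ML_test V /\ forall V', ML_test V' -> subset_c (bigcap_c V') (bigcap_c V).

Definition eff_measurable (A : cantor -> Prop) : Prop :=
  exists U V : nat -> cantor -> Prop,
    unif_eff_open U /\ unif_eff_open V /\
    forall i, subset_c (fun X => ~ V i X) A /\ subset_c A (U i) /\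
              Rbar_le (lambda_open (fun X => U i X /\ V i X)) (Finite (/ 2 ^ i)).

Definition layerwise_semidecidable (W : nat -> cantor -> Prop)
    (A : cantor -> Prop) : Prop :=
  exists U : nat -> cantor -> Prop, unif_eff_open U /\
    forall i X, ~ W i X -> (A X <-> U i X).

Definition layerwise_decidable (W : nat -> cantor -> Prop)
    (A : cantor -> Prop) : Prop :=
  layerwise_semidecidable W A /\ layerwise_semidecidable W (fun X => ~ A X).

(* Main.v *)
From Coquelicot Require Import Coquelicot.
Require Import Defs.
From Stdlib Require Import Reals List Arith Lia Lra Bool.
From Stdlib Require Import Classical ClassicalDescription.
Import ListNotations.
Local Open Scope nat_scope.
Set Bullet Behavior "Strict Subproofs".

(** Let [V] be a universal test and [tau s] a string of length [s] whose cylinder is not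
    contained in stage [s] of [V 1]. An accumulation point [X] of these strings avoids
    [V 1], so [X] is random and lies in none of the cylinders [[tau n]], [n >= M], for some
    [M], because their tails form a test. The union [A] of these cylinders is open with
    computable measure, hence effectively measurable, but [X] is a limit of points of [A]
    and not in [A]. It remains to find a universal test whose level 0 misses both [X] and
    points of [A] converging to [X]. Only level 0 matters, and its measure bound is void:
    let it enumerate [V 1], except that inside the first cylinder [[tau n]], [n >= M],
    containing the point it enumerates [V (n + 1)], whose measure is smaller than that of
    [[tau n]]. Off level 0, the complement of [A] is then not even relatively open. *)

(** * Total computable functions *)

(** The delicate point is that level 0 of the modified test must be open, although it depends on the
    first cylinder [[tau n]] around a point, and [n] can be arbitrarily large. At stage [s] only the
    cylinders with [n <= s] can be ruled out, so a point might be enumerated from [V 1] before it is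
    known to lie in some [[tau n]] with [n > s]. The choice of [tau n] excludes this conflict: stage
    [n] of [V 1] is determined by the first [n] bits, so a cylinder of length [n] not contained in
    it is disjoint from it, and nothing that [V 1] enumerates up to stage [n] touches [[tau n]].
    Hence stages, and not only open sets, enter the construction. A point of the whole intersection
    still enters level 0, since it lies in [V 1] and in every [V (n + 1)]. The number [M] depends on
    [X] and is not found effectively, but a single constant may be built into both [A] and the test.
    As [ce] refers to codes of partial recursive functions, the universal test rests on an
    interpreter for these codes. *)

Lemma code_ind_nested (P : code -> Prop) :
  P CZero -> P CSucc -> (forall i, P (CProj i)) ->
  (forall f gs, P f -> Forall P gs -> P (CComp f gs)) ->
  (forall f g, P f -> P g -> P (CPrec f g)) ->
  (forall f, P f -> P (CMu f)) -> forall c, P c.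
Proof.
  intros H0 HS Hp Hc Hr Hm.
  fix IH 1. intros [| |i|f gs|f g|f].
  - exact H0.
  - exact HS.
  - apply Hp.
  - apply Hc; [apply IH|].
    induction gs as [|g gs IHgs]; constructor; [apply IH|apply IHgs].
  - apply Hr; apply IH.
  - apply Hm, IH.
Qed.

(** Determinism lets [ce_of_decidable] compare a value met in a search with the known value of the
    test. *)
Lemma eval_det c : forall v y z, eval c v y -> eval c v z -> y = z.
Proof.
  induction c as [| |i|f gs IHf IHgs|f g IHf IHg|f IHf] using code_ind_nested;
    intros v y z Hy Hz.
  - inversion Hy; inversion Hz; congruence.
  - inversion Hy; inversion Hz; congruence.
  - inversion Hy; inversion Hz; congruence.
  - inversion Hy as [| | |f1 gs1 v1 ws y1 Hws Hf| | |]; subst.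
    inversion Hz as [| | |f2 gs2 v2 ws' y2 Hws' Hf'| | |]; subst.
    enough (ws = ws') by (subst; eauto).
    clear Hf Hf' Hy Hz IHf.
    revert ws ws' Hws Hws'. induction IHgs as [|g gs Hg _ IH]; intros ws ws' H1 H2.
    + inversion H1; inversion H2; congruence.
    + inversion H1; inversion H2; subst. f_equal; eauto.
  - destruct v as [|n v]; [inversion Hy|].
    revert y z Hy Hz. induction n as [|n IHn]; intros y z Hy Hz.
    + inversion Hy; inversion Hz; subst; eauto.
    + inversion Hy as [| | | | |f1 g1 n1 v1 r y1 Hr Hg|]; subst.
      inversion Hz as [| | | | |f2 g2 n2 v2 r' y2 Hr' Hg'|]; subst.
      rewrite (IHn _ _ Hr' Hr) in Hg'. eauto.
  - inversion Hy as [| | | | | |f1 v1 n1 H0 Hlt]; subst.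
    inversion Hz as [| | | | | |f2 v2 n2 H0' Hlt']; subst.
    destruct (lt_eq_lt_dec y z) as [[H|H]|H]; auto; exfalso.
    + destruct (Hlt' y H) as [k Hk]. discriminate (IHf _ _ _ H0 Hk).
    + destruct (Hlt z H) as [k Hk]. discriminate (IHf _ _ _ H0' Hk).
Qed.

(** The code is hidden behind an existential, so closure lemmas keyed to the shape of a Rocq term
    let [auto] find programs that are never written out. *)
Definition computable (k : nat) (f : list nat -> nat) : Prop :=
  exists c, forall v, length v = k -> eval c v (f v).

Definition computableb (k : nat) (p : list nat -> bool) : Prop :=
  computable k (fun v => Nat.b2n (p v)).

Lemma computable_ext k f g : (forall v, length v = k -> f v = g v) -> computable k f -> computable k g.
Proof. intros E [c Hc]. exists c. intros v Hv. rewrite <- (E v Hv). auto. Qed.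

Lemma computableb_ext k p q : (forall v, length v = k -> p v = q v) -> computableb k p -> computableb k q.
Proof. intros E. apply computable_ext. intros v Hv. now rewrite (E v Hv). Qed.

Lemma computable_var k i : i < k -> computable k (fun v => nth i v 0).
Proof. intros Hi. exists (CProj i). intros v Hv. constructor. lia. Qed.

Lemma computable_subst k f gs :
  computable (length gs) f -> Forall (computable k) gs ->
  computable k (fun v => f (map (fun g => g v) gs)).
Proof.
  intros [c Hc] Hgs.
  assert (exists cs, forall v, length v = k -> evals cs v (map (fun g => g v) gs))
    as [cs Hcs].
  { clear Hc. induction Hgs as [|g gs [cg Hg] _ [cs Hcs]].
    - exists []. intros. constructor.
    - exists (cg :: cs). intros v Hv. simpl. constructor; auto. }
  exists (CComp c cs). intros v Hv. econstructor; [eauto|].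
  apply Hc. now rewrite length_map.
Qed.

(** By substitution, a closure lemma only has to treat projections as arguments. *)
Lemma computable_app1 k f a :
  computable 1 (fun v => f (nth 0 v 0)) -> computable k a -> computable k (fun v => f (a v)).
Proof.
  intros Hf Ha. apply (computable_subst k _ [a]) in Hf; auto.
Qed.

Lemma computable_app2 k f a b :
  computable 2 (fun v => f (nth 0 v 0) (nth 1 v 0)) ->
  computable k a -> computable k b -> computable k (fun v => f (a v) (b v)).
Proof.
  intros Hf Ha Hb. apply (computable_subst k _ [a; b]) in Hf; auto.
Qed.

Lemma computable_app3 k f a b c :
  computable 3 (fun v => f (nth 0 v 0) (nth 1 v 0) (nth 2 v 0)) ->
  computable k a -> computable k b -> computable k c -> computable k (fun v => f (a v) (b v) (c v)).
Proof.
  intros Hf Ha Hb Hc. apply (computable_subst k _ [a; b; c]) in Hf; auto.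
Qed.

Lemma computable_app4 k f a b c d :
  computable 4 (fun v => f (nth 0 v 0) (nth 1 v 0) (nth 2 v 0) (nth 3 v 0)) ->
  computable k a -> computable k b -> computable k c -> computable k d ->
  computable k (fun v => f (a v) (b v) (c v) (d v)).
Proof.
  intros Hf Ha Hb Hc Hd. apply (computable_subst k _ [a; b; c; d]) in Hf; auto.
Qed.

Lemma computable_app5 k f a b c d e :
  computable 5 (fun v => f (nth 0 v 0) (nth 1 v 0) (nth 2 v 0) (nth 3 v 0) (nth 4 v 0)) ->
  computable k a -> computable k b -> computable k c -> computable k d -> computable k e ->
  computable k (fun v => f (a v) (b v) (c v) (d v) (e v)).
Proof.
  intros Hf Ha Hb Hc Hd He. apply (computable_subst k _ [a; b; c; d; e]) in Hf; auto 10.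
Qed.

Lemma nth_map_seq (v : list nat) j l :
  j + l = length v -> map (fun i => nth i v 0) (seq j l) = skipn j v.
Proof.
  revert j. induction l as [|l IH]; intros j Hj; simpl.
  - rewrite skipn_all2; auto; lia.
  - rewrite IH by lia.
    assert (Hlt : j < length v) by lia.
    clear - Hlt. revert j Hlt. induction v as [|x v IHv]; intros j Hj; [simpl in Hj; lia|].
    destruct j; simpl in *; auto. apply IHv. lia.
Qed.

(** Weakening: recursion and bounded search push their variables onto the front of the vector, so
    the parameters sit in its tail. *)
Lemma computable_tl k f : computable k f -> computable (S k) (fun w => f (tl w)).
Proof.
  intros Hf.
  set (gs := map (fun i => fun v : list nat => nth i v 0) (seq 1 k)).
  assert (Hl : length gs = k) by (unfold gs; rewrite length_map, length_seq; auto).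
  rewrite <- Hl in Hf at 1.
  apply (computable_subst (S k) _ gs) in Hf.
  - revert Hf. apply computable_ext. intros v Hv. f_equal. unfold gs.
    rewrite map_map. rewrite nth_map_seq by lia. now destruct v.
  - apply Forall_forall. intros g Hg. unfold gs in Hg.
    apply in_map_iff in Hg as (i & <- & Hi). apply in_seq in Hi. apply computable_var. lia.
Qed.

Lemma computable_nth_tl k j g :
  computable k (fun v => nth (S j) (g v) 0) -> computable k (fun v => nth j (tl (g v)) 0).
Proof.
  apply computable_ext. intros v _. destruct (g v); simpl; auto. now destruct j.
Qed.

Lemma computable_succ k a : computable k a -> computable k (fun v => S (a v)).
Proof.
  apply (computable_app1 k S a). exists CSucc. intros [|x [|]] Hv; try discriminate. constructor.
Qed.

Lemma computable_const k n : computable k (fun _ => n).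
Proof.
  induction n.
  - exists CZero. constructor.
  - apply (computable_succ k (fun _ => n)). auto.
Qed.

Lemma computable_rec k a (g : nat -> nat -> list nat -> nat) n :
  computable k a -> computable (S (S k)) (fun w => g (nth 0 w 0) (nth 1 w 0) (tl (tl w))) ->
  computable k n ->
  computable k (fun v => nat_rect (fun _ => nat) (a v) (fun i r => g i r v) (n v)).
Proof.
  intros [ca Ha] [cg Hg] Hn.
  set (F := fun w => nat_rect (fun _ => nat) (a (tl w)) (fun i r => g i r (tl w)) (nth 0 w 0)).
  assert (HF : computable (S k) F).
  { exists (CPrec ca cg). intros [|m v] Hv; [discriminate|].
    injection Hv as Hv. unfold F. simpl. induction m as [|m IH]; simpl.
    - constructor. auto.
    - econstructor; [exact IH|].
      apply (Hg (m :: _ :: v)). simpl. auto. }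
  set (gs := n :: map (fun i => fun v : list nat => nth i v 0) (seq 0 k)).
  assert (Hl : length gs = S k) by (unfold gs; simpl; rewrite length_map, length_seq; auto).
  rewrite <- Hl in HF at 1.
  apply (computable_subst k _ gs) in HF.
  - revert HF. apply computable_ext. intros v Hv. unfold gs, F. simpl.
    rewrite map_map. rewrite nth_map_seq by lia. reflexivity.
  - constructor; auto. apply Forall_forall. intros h Hh.
    apply in_map_iff in Hh as (i & <- & Hi). apply in_seq in Hi. apply computable_var. lia.
Qed.

Create HintDb computable.
#[local] Hint Constants Opaque : computable.
#[local] Hint Resolve computable_succ computable_const computable_nth_tl computable_tl : computable.
#[local] Hint Extern 1 (computable _ (fun v => nth _ v 0)) => apply computable_var; lia : computable.
Ltac computable_auto := auto 60 with computable.

Lemma computable_pred k a : computable k a -> computable k (fun v => pred (a v)).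
Proof.
  apply (computable_app1 k pred).
  apply computable_ext with (fun v => nat_rect (fun _ => nat) 0 (fun i r => i) (nth 0 v 0)).
  - intros v _. destruct (nth 0 v 0); reflexivity.
  - apply computable_rec with (g := fun i r v => i); computable_auto.
Qed.
#[local] Hint Resolve computable_pred : computable.

Lemma computable_add k a b : computable k a -> computable k b -> computable k (fun v => a v + b v).
Proof.
  apply (computable_app2 k Nat.add).
  apply computable_ext with (fun v => nat_rect (fun _ => nat) (nth 0 v 0) (fun i r => S r) (nth 1 v 0)).
  - intros v _. induction (nth 1 v 0); simpl; lia.
  - apply computable_rec with (g := fun i r v => S r); computable_auto.
Qed.
#[local] Hint Resolve computable_add : computable.

Lemma computable_sub k a b : computable k a -> computable k b -> computable k (fun v => a v - b v).
Proof.
  apply (computable_app2 k Nat.sub).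
  apply computable_ext with (fun v => nat_rect (fun _ => nat) (nth 0 v 0) (fun i r => pred r) (nth 1 v 0)).
  - intros v _. induction (nth 1 v 0); simpl; lia.
  - apply computable_rec with (g := fun i r v => pred r); computable_auto.
Qed.
#[local] Hint Resolve computable_sub : computable.

Lemma computable_mul k a b : computable k a -> computable k b -> computable k (fun v => a v * b v).
Proof.
  apply (computable_app2 k Nat.mul).
  apply computable_ext with (fun v => nat_rect (fun _ => nat) 0 (fun i r => r + nth 0 v 0) (nth 1 v 0)).
  - intros v _. induction (nth 1 v 0); simpl; lia.
  - apply computable_rec with (g := fun i r v => r + nth 0 v 0); computable_auto.
Qed.
#[local] Hint Resolve computable_mul : computable.

Lemma computable_pow2 k a : computable k a -> computable k (fun v => 2 ^ a v).
Proof.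
  apply (computable_app1 k (fun n => 2 ^ n)).
  apply computable_ext with (fun v => nat_rect (fun _ => nat) 1 (fun i r => r + r) (nth 0 v 0)).
  - intros v _. induction (nth 0 v 0); simpl; lia.
  - apply computable_rec with (g := fun i r v => r + r); computable_auto.
Qed.
#[local] Hint Resolve computable_pow2 : computable.

Lemma computableb_leb k a b : computable k a -> computable k b -> computableb k (fun v => a v <=? b v).
Proof.
  intros Ha Hb. apply computable_ext with (fun v => 1 - (a v - b v)).
  - intros v _. destruct (Nat.leb_spec (a v) (b v)); unfold Nat.b2n; lia.
  - computable_auto.
Qed.

Lemma computableb_ltb k a b : computable k a -> computable k b -> computableb k (fun v => a v <? b v).
Proof. intros Ha Hb. apply (computableb_leb k (fun v => S (a v))); computable_auto. Qed.

Lemma computableb_eqb k a b : computable k a -> computable k b -> computableb k (fun v => a v =? b v).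
Proof.
  intros Ha Hb. apply computable_ext with (fun v => 1 - ((a v - b v) + (b v - a v))).
  - intros v _. destruct (Nat.eqb_spec (a v) (b v)); unfold Nat.b2n; lia.
  - computable_auto.
Qed.

Lemma computableb_negb k p : computableb k p -> computableb k (fun v => negb (p v)).
Proof.
  intros Hp. apply computable_ext with (fun v => 1 - Nat.b2n (p v)).
  - intros v _. destruct (p v); reflexivity.
  - apply computable_sub; computable_auto.
Qed.

Lemma computableb_andb k p q : computableb k p -> computableb k q -> computableb k (fun v => p v && q v).
Proof.
  intros Hp Hq. apply computable_ext with (fun v => Nat.b2n (p v) * Nat.b2n (q v)).
  - intros v _. destruct (p v), (q v); reflexivity.
  - apply computable_mul; auto.
Qed.

Lemma computableb_orb k p q : computableb k p -> computableb k q -> computableb k (fun v => p v || q v).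
Proof.
  intros Hp Hq.
  apply computableb_ext with (fun v => negb (negb (p v) && negb (q v))).
  - intros v _. destruct (p v), (q v); reflexivity.
  - apply computableb_negb, computableb_andb; apply computableb_negb; auto.
Qed.

Lemma computable_if k p a b :
  computableb k p -> computable k a -> computable k b -> computable k (fun v => if p v then a v else b v).
Proof.
  intros Hp Ha Hb.
  apply computable_ext with (fun v => Nat.b2n (p v) * a v + (1 - Nat.b2n (p v)) * b v).
  - intros v _. destruct (p v); simpl; lia.
  - apply computable_add; apply computable_mul; auto. apply computable_sub; computable_auto.
Qed.

Lemma computableb_if k p a b :
  computableb k p -> computableb k a -> computableb k b -> computableb k (fun v => if p v then a v else b v).
Proof.
  intros Hp Ha Hb.
  apply computable_ext with (fun v => if p v then Nat.b2n (a v) else Nat.b2n (b v)).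
  - intros v _. destruct (p v); reflexivity.
  - apply computable_if; auto.
Qed.
#[local] Hint Resolve computableb_leb computableb_ltb computableb_eqb computableb_negb computableb_andb computableb_orb
  computable_if computableb_if : computable.

(** * Bounded counting, quantifiers and search *)

Definition count (n : nat) (p : nat -> bool) : nat :=
  nat_rect (fun _ => nat) 0 (fun i r => r + Nat.b2n (p i)) n.

Lemma computable_count k n (p : nat -> list nat -> bool) :
  computable k n -> computableb (S k) (fun w => p (nth 0 w 0) (tl w)) ->
  computable k (fun v => count (n v) (fun i => p i v)).
Proof.
  intros Hn Hp. apply computable_rec with (g := fun i r v => r + Nat.b2n (p i v)); computable_auto.
  apply computable_add; computable_auto.
  (* The recursion runs on index, accumulator and parameters; [gs] drops the accumulator, which [p]
     does not take. *)
  set (gs := (fun w => nth 0 w 0) :: map (fun i => fun v : list nat => nth i v 0) (seq 2 k)).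
  assert (Hl : length gs = S k) by (unfold gs; simpl; rewrite length_map, length_seq; auto).
  unfold computableb in Hp. rewrite <- Hl in Hp at 1.
  apply (computable_subst (S (S k)) _ gs) in Hp.
  - revert Hp. apply computable_ext. intros v Hv. unfold gs. simpl.
    rewrite map_map, nth_map_seq by lia.
    destruct v as [|? [|]]; auto.
  - constructor; computable_auto. apply Forall_forall. intros h Hh.
    apply in_map_iff in Hh as (i & <- & Hi). apply in_seq in Hi. apply computable_var. lia.
Qed.

Lemma count_le n p q : (forall i, i < n -> p i = true -> q i = true) -> count n p <= count n q.
Proof.
  intros H. induction n as [|n IH]; simpl; auto.
  specialize (IH ltac:(auto)). specialize (H n ltac:(auto)).
  destruct (p n); simpl; [rewrite H by auto; simpl|]; lia.
Qed.

Lemma count_ext n p q : (forall i, i < n -> p i = q i) -> count n p = count n q.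
Proof.
  intros H. apply Nat.le_antisymm; apply count_le; intros i Hi; rewrite H; auto.
Qed.

(** Quantifiers are expressed by counting, so that the one recursion [count] serves logic as well as
    measure. *)
Definition bex (n : nat) (p : nat -> bool) : bool := 1 <=? count n p.
Definition ball (n : nat) (p : nat -> bool) : bool := negb (bex n (fun i => negb (p i))).

Lemma bex_spec n p : bex n p = true <-> exists i, i < n /\ p i = true.
Proof.
  unfold bex. rewrite Nat.leb_le. induction n as [|n IH]; simpl.
  - split; [lia|]. intros (i & Hi & _). lia.
  - destruct (p n) eqn:E; simpl.
    + split; [|lia]. intros _. exists n. auto.
    + rewrite Nat.add_0_r, IH. split; intros (i & Hi & Hp).
      * exists i. auto.
      * exists i. split; auto. assert (i <> n) by congruence. lia.
Qed.

Lemma ball_spec n p : ball n p = true <-> forall i, i < n -> p i = true.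
Proof.
  unfold ball. rewrite negb_true_iff. split.
  - intros H i Hi. destruct (p i) eqn:E; auto.
    enough (bex n (fun i => negb (p i)) = true) by congruence.
    apply bex_spec. exists i. rewrite E. auto.
  - intros H. destruct (bex n _) eqn:E; auto.
    apply bex_spec in E as (i & Hi & E). rewrite H in E; auto.
Qed.

Lemma computableb_bex k n (p : nat -> list nat -> bool) :
  computable k n -> computableb (S k) (fun w => p (nth 0 w 0) (tl w)) ->
  computableb k (fun v => bex (n v) (fun i => p i v)).
Proof.
  intros. apply computableb_leb; [computable_auto|]. apply computable_count; auto.
Qed.

Lemma computableb_ball k n (p : nat -> list nat -> bool) :
  computable k n -> computableb (S k) (fun w => p (nth 0 w 0) (tl w)) ->
  computableb k (fun v => ball (n v) (fun i => p i v)).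
Proof.
  intros. apply computableb_negb, computableb_bex with (p := fun i v => negb (p i v)); auto.
  apply computableb_negb. auto.
Qed.

(** The recursion argument only limits the number of steps: [r] climbs until it meets a witness and
    then stays, so the default value is [n]. *)
Definition least (n : nat) (p : nat -> bool) : nat :=
  nat_rect (fun _ => nat) 0 (fun _ r => if p r then r else S r) n.

Lemma least_spec n p : least n p < n /\ p (least n p) = true \/
  least n p = n /\ forall j, j < n -> p j = false.
Proof.
  induction n as [|n IH]; simpl.
  - right. split; auto. lia.
  - destruct IH as [[H1 H2]|[H1 H2]].
    + rewrite H2. auto.
    + rewrite H1. destruct (p n) eqn:E; [auto|].
      right. split; auto. intros j Hj. destruct (Nat.eq_dec j n); [congruence|].
      apply H2. lia.
Qed.

Lemma least_min n p j : j < least n p -> p j = false.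
Proof.
  induction n as [|n IH]; simpl; [lia|].
  destruct (p (least n p)) eqn:E; auto.
  intros Hj. destruct (Nat.eq_dec j (least n p)); [congruence|]. apply IH. lia.
Qed.

Lemma least_ex n p : (exists i, i < n /\ p i = true) ->
  least n p < n /\ p (least n p) = true.
Proof.
  intros (i & Hi & Hp). destruct (least_spec n p) as [H|[_ H]]; auto.
  rewrite H in Hp; [discriminate|auto].
Qed.

Lemma least_unique n p j : j < n -> p j = true -> (forall i, p i = true -> i = j) ->
  least n p = j.
Proof.
  intros Hj Hp Hu. apply Hu. apply least_ex. eauto.
Qed.

Lemma computable_least k n (p : nat -> list nat -> bool) :
  computable k n -> computableb (S k) (fun w => p (nth 0 w 0) (tl w)) ->
  computable k (fun v => least (n v) (fun i => p i v)).
Proof.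
  intros Hn Hp.
  apply computable_rec with (g := fun i r v => if p r v then r else S r); computable_auto.
  apply computable_if; computable_auto.
  apply (computable_tl (S k) (fun w => Nat.b2n (p (nth 0 w 0) (tl w)))) in Hp.
  revert Hp. apply computableb_ext. intros [|? [|]] Hv; auto; discriminate.
Qed.
#[local] Hint Resolve computable_count computableb_bex computableb_ball computable_least : computable.

Lemma computable_div k a b : computable k a -> computable k b -> computable k (fun v => a v / b v).
Proof.
  apply (computable_app2 k Nat.div).
  (* [Nat.div] returns 0 for the divisor 0; otherwise the quotient is the least [q] with
     [x < (q + 1) * y], and [q = x] bounds the search. *)
  apply computable_ext with (fun v => if nth 1 v 0 =? 0 then 0 else
    least (S (nth 0 v 0)) (fun q => nth 0 v 0 <? S q * nth 1 v 0)).
  - intros v _. generalize (nth 0 v 0) (nth 1 v 0). intros x y.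
    destruct (Nat.eqb_spec y 0) as [->|Hy]; auto.
    assert (E : exists q, q < S x /\ (x <? S q * y) = true).
    { exists x. split; auto. apply Nat.ltb_lt. nia. }
    destruct (least_ex _ _ E) as [H1 H2].
    set (q := least _ _) in *. apply Nat.ltb_lt in H2.
    assert (H3 : q * y <= x).
    { destruct q as [|q'] eqn:Eq; [lia|].
      assert (H3 : (x <? S q' * y) = false).
      { apply (least_min (S x) (fun q => x <? S q * y)). fold q. lia. }
      apply Nat.ltb_ge in H3. auto. }
    apply Nat.div_unique with (x - q * y); nia.
  - computable_auto.
Qed.
#[local] Hint Resolve computable_div : computable.

Lemma computable_mod k a b : computable k a -> computable k b -> computable k (fun v => a v mod b v).
Proof.
  intros Ha Hb. apply computable_ext with (fun v => a v - b v * (a v / b v)).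
  - intros v _. now rewrite Nat.Div0.mod_eq.
  - computable_auto.
Qed.
#[local] Hint Resolve computable_mod : computable.

Lemma computableb_testbit k a b : computable k a -> computable k b -> computableb k (fun v => Nat.testbit (a v) (b v)).
Proof.
  intros Ha Hb. apply computableb_ext with (fun v => (a v / 2 ^ b v) mod 2 =? 1).
  - intros v _. rewrite Nat.testbit_eqb. reflexivity.
  - computable_auto.
Qed.
#[local] Hint Resolve computableb_testbit : computable.

Lemma computable_pairing k a b : computable k a -> computable k b -> computable k (fun v => pairing (a v) (b v)).
Proof. intros Ha Hb. unfold pairing. computable_auto. Qed.
#[local] Hint Resolve computable_pairing : computable.

(** [CMu] looks for a zero, hence the test [1 - b2n]. Before the least witness this total test has
    the value 1, as the rule for [CMu] demands. *)
Lemma ce_of_decidable (p : nat -> nat -> bool) (P : nat -> Prop) :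
  computableb 2 (fun v => p (nth 0 v 0) (nth 1 v 0)) ->
  (forall n, P n <-> exists s, p s n = true) -> ce P.
Proof.
  intros Hp HP.
  assert (Hq : computable 2 (fun v => 1 - Nat.b2n (p (nth 0 v 0) (nth 1 v 0))))
    by (apply computable_sub; computable_auto).
  destruct Hq as [c Hc].
  assert (Hc' : forall s n, eval c [s; n] (1 - Nat.b2n (p s n)))
    by (intros s n; apply (Hc [s; n]); auto).
  exists (CMu c). intros n. rewrite HP. split.
  - intros [s Hs].
    destruct (least_ex (S s) (fun s => p s n)) as [_ H]; [eauto|].
    set (m := least _ _) in *.
    exists m. constructor.
    + specialize (Hc' m n). rewrite H in Hc'. exact Hc'.
    + intros j Hj. exists 0. specialize (Hc' j n).
      rewrite (least_min (S s) (fun s => p s n)) in Hc' by auto. exact Hc'.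
  - intros [y Hy]. inversion Hy as [| | | | | |f v m H0 Hlt]; subst.
    exists y. apply (eval_det _ _ _ _ (Hc' y n)) in H0.
    destruct (p y n); auto; discriminate.
Qed.

(** * A universal computably enumerable predicate *)

(** The division in [pairing] is exact, so arithmetic on codes becomes polynomial. *)
Lemma triangle_double n : 2 * (n * (n + 1) / 2) = n * (n + 1).
Proof.
  assert (H : (n * (n + 1)) mod 2 = 0).
  { induction n as [|n IH]; auto.
    replace (S n * (S n + 1)) with (n * (n + 1) + (n + 1) * 2) by lia.
    rewrite Nat.Div0.mod_add. auto. }
  pose proof (Nat.div_mod_eq (n * (n + 1)) 2). lia.
Qed.

Lemma pairing_inj i j i' j' : pairing i j = pairing i' j' -> i = i' /\ j = j'.
Proof.
  unfold pairing. intros H.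
  pose proof (triangle_double (i + j)). pose proof (triangle_double (i' + j')).
  set (t := _ / 2) in *. set (t' := (i' + j') * _ / 2) in *. clearbody t t'.
  (* A code lies between two consecutive triangular numbers, and these determine the sum of the
     components. *)
  assert (E : i + j = i' + j').
  { destruct (lt_eq_lt_dec (i + j) (i' + j')) as [[Hl|Hl]|Hl]; auto; exfalso.
    - assert ((i + j + 1) * (i + j + 2) <= (i' + j') * (i' + j' + 1))
        by (apply Nat.mul_le_mono; lia). nia.
    - assert ((i' + j' + 1) * (i' + j' + 2) <= (i + j) * (i + j + 1))
        by (apply Nat.mul_le_mono; lia). nia. }
  rewrite E in H0. lia.
Qed.

Lemma pairing_ge i j : i <= pairing i j /\ j <= pairing i j.
Proof.
  unfold pairing. pose proof (triangle_double (i + j)).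
  set (t := _ / 2) in *. clearbody t. nia.
Qed.

(** Components are at most their code, so a bounded search finds them. On a number not recognized as
    a pair the result is the default [S n]; therefore [justified] rechecks that an output vector
    really is a pair. *)
Definition pfst (n : nat) : nat := least (S n) (fun i => bex (S n) (fun j => pairing i j =? n)).
Definition psnd (n : nat) : nat := least (S n) (fun j => bex (S n) (fun i => pairing i j =? n)).

Lemma pfst_pairing i j : pfst (pairing i j) = i.
Proof.
  destruct (pairing_ge i j). apply least_unique; [lia| |].
  - apply bex_spec. exists j. split; [lia|]. now apply Nat.eqb_eq.
  - intros i' H'. apply bex_spec in H' as (j' & _ & E). apply Nat.eqb_eq in E.
    now apply pairing_inj in E.
Qed.

Lemma psnd_pairing i j : psnd (pairing i j) = j.
Proof.
  destruct (pairing_ge i j). apply least_unique; [lia| |].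
  - apply bex_spec. exists i. split; [lia|]. now apply Nat.eqb_eq.
  - intros i' H'. apply bex_spec in H' as (j' & _ & E). apply Nat.eqb_eq in E.
    now apply pairing_inj in E.
Qed.

Lemma computable_pfst k a : computable k a -> computable k (fun v => pfst (a v)).
Proof. apply (computable_app1 k pfst). unfold pfst. computable_auto. Qed.

Lemma computable_psnd k a : computable k a -> computable k (fun v => psnd (a v)).
Proof. apply (computable_app1 k psnd). unfold psnd. computable_auto. Qed.
#[local] Hint Resolve computable_pfst computable_psnd : computable.

Local Arguments pairing : simpl never.
Local Arguments pfst : simpl never.
Local Arguments psnd : simpl never.
Local Arguments fact : simpl never.
Local Arguments bex : simpl never.
Local Arguments ball : simpl never.

(** * Coding of programs and of finite sets of evaluation facts *)

Fixpoint ncode (c : code) : nat :=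
  match c with
  | CZero => pairing 0 0
  | CSucc => pairing 1 0
  | CProj i => pairing 2 i
  | CComp f gs => pairing 3 (pairing (ncode f)
      (fold_right (fun g n => S (pairing (ncode g) n)) 0 gs))
  | CPrec f g => pairing 4 (pairing (ncode f) (ncode g))
  | CMu f => pairing 5 (ncode f)
  end.

Definition nvec (v : list nat) : nat := fold_right (fun x n => S (pairing x n)) 0 v.
Definition ncodes (gs : list code) : nat := nvec (map ncode gs).

Lemma ncode_comp f gs : ncode (CComp f gs) = pairing 3 (pairing (ncode f) (ncodes gs)).
Proof.
  simpl. f_equal. f_equal. induction gs; simpl; auto. now rewrite IHgs.
Qed.

(* A finite set of facts is coded by the number [D] having those bits; the kinds are
   0: [eval c v y], 1: [evals c v y], 2: the [c]-th entry of [v] is [y]. The set needs no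
   order: every premise concerns a subcode or a smaller recursion argument, so local
   justification is already sound. *)
Definition fact (D k c v y : nat) : bool :=
  Nat.testbit D (pairing k (pairing c (pairing v y))).

(** There is one clause for each rule of [eval] and [evals]. The existential premises may be
    searched below [D], since the arguments and values occurring in a fact of [D] are smaller than
    [D]. *)
Definition justified (D k c v y : nat) : bool :=
  if k =? 0 then
    if pfst c =? 0 then y =? 0
    else if pfst c =? 1 then (1 <=? v) && (y =? S (pfst (pred v)))
    else if pfst c =? 2 then fact D 2 (psnd c) v y
    else if pfst c =? 3 then
      bex D (fun ws => fact D 1 (psnd (psnd c)) v ws && fact D 0 (pfst (psnd c)) ws y)
    else if pfst c =? 4 then
      (1 <=? v) &&
      if pfst (pred v) =? 0 then fact D 0 (pfst (psnd c)) (psnd (pred v)) y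
      else bex D (fun r =>
        fact D 0 c (S (pairing (pred (pfst (pred v))) (psnd (pred v)))) r &&
        fact D 0 (psnd (psnd c))
          (S (pairing (pred (pfst (pred v))) (S (pairing r (psnd (pred v)))))) y)
    else
      fact D 0 (psnd c) (S (pairing y v)) 0 &&
      ball y (fun m => bex D (fun r => fact D 0 (psnd c) (S (pairing m v)) (S r)))
  else if k =? 1 then
    if c =? 0 then y =? 0
    else (1 <=? y) && (pred y =? pairing (pfst (pred y)) (psnd (pred y))) &&
      (fact D 0 (pfst (pred c)) v (pfst (pred y)) &&
       fact D 1 (psnd (pred c)) v (psnd (pred y)))
  else
    (1 <=? v) &&
    if c =? 0 then y =? pfst (pred v) else fact D 2 (pred c) (psnd (pred v)) y.

Definition closed_facts (D : nat) : bool :=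
  ball D (fun x => negb (Nat.testbit D x) ||
    justified D (pfst x) (pfst (psnd x)) (pfst (psnd (psnd x))) (psnd (psnd (psnd x)))).

(** The stage [s] is itself the coded derivation. This makes the predicate decidable but not
    monotone in [s]; [covered] restores monotonicity by searching all smaller stages. *)
Definition univ (e n s : nat) : bool :=
  closed_facts s && bex s (fun y => fact s 0 e (S (pairing n 0)) y).

Lemma computableb_fact n D k c v y : computable n D -> computable n k -> computable n c -> computable n v -> computable n y ->
  computableb n (fun w => fact (D w) (k w) (c w) (v w) (y w)).
Proof. unfold fact. computable_auto. Qed.
#[local] Hint Resolve computableb_fact : computable.

Lemma computableb_justified n D k c v y :
  computable n D -> computable n k -> computable n c -> computable n v -> computable n y ->
  computableb n (fun w => justified (D w) (k w) (c w) (v w) (y w)).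
Proof.
  apply (computable_app5 n (fun D k c v y => Nat.b2n (justified D k c v y))).
  change (computableb 5 (fun v => justified (nth 0 v 0) (nth 1 v 0) (nth 2 v 0) (nth 3 v 0) (nth 4 v 0))).
  unfold justified. computable_auto.
Qed.
#[local] Hint Resolve computableb_justified : computable.

Lemma computableb_univ n e x s : computable n e -> computable n x -> computable n s ->
  computableb n (fun w => univ (e w) (x w) (s w)).
Proof.
  apply (computable_app3 n (fun e x s => Nat.b2n (univ e x s))).
  change (computableb 3 (fun v => univ (nth 0 v 0) (nth 1 v 0) (nth 2 v 0))).
  unfold univ, closed_facts. computable_auto.
Qed.
#[local] Hint Resolve computableb_univ : computable.

Lemma testbit_lt D x : Nat.testbit D x = true -> x < D.
Proof.
  intros H. destruct (Nat.eq_dec D 0) as [->|HD]; [rewrite Nat.bits_0 in H; discriminate|].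
  destruct (le_lt_dec x (Nat.log2 D)) as [Hx|Hx].
  - pose proof (Nat.log2_lt_lin D). lia.
  - rewrite Nat.bits_above_log2 in H; auto. discriminate.
Qed.

Lemma fact_lt D k c v y : fact D k c v y = true -> v < D /\ y < D.
Proof.
  intros H. apply testbit_lt in H.
  pose proof (pairing_ge k (pairing c (pairing v y))).
  pose proof (pairing_ge c (pairing v y)). pose proof (pairing_ge v y). lia.
Qed.

Definition sound_facts (D : nat) : Prop :=
  forall k c v y, fact D k c v y = true -> justified D k c v y = true.

Lemma closed_facts_sound D : closed_facts D = true -> sound_facts D.
Proof.
  intros H k c v y Hf. unfold closed_facts in H. rewrite ball_spec in H.
  specialize (H _ (testbit_lt _ _ Hf)). unfold fact in Hf. rewrite Hf in H.
  rewrite !pfst_pairing, !psnd_pairing, ?pfst_pairing, ?psnd_pairing in H. exact H.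
Qed.

Ltac unpair H := rewrite ?pfst_pairing, ?psnd_pairing, ?pfst_pairing, ?psnd_pairing in H.

Lemma fact_nth D : sound_facts D -> forall v i y, fact D 2 i (nvec v) y = true ->
  i < length v /\ y = nth i v 0.
Proof.
  intros HD. induction v as [|x v IH]; intros i y H; apply HD in H; unfold justified in H; simpl in H.
  - discriminate.
  - unpair H. destruct i; simpl in *.
    + apply Nat.eqb_eq in H. split; [lia|auto].
    + apply IH in H. split; [lia|tauto].
Qed.

Lemma fact_eval D : sound_facts D -> forall c v y, fact D 0 (ncode c) (nvec v) y = true ->
  eval c v y.
Proof.
  intros HD.
  induction c as [| |i|f gs IHf IHgs|f g IHf IHg|f IHf] using code_ind_nested; intros v y H.
  - apply HD in H. unfold justified in H. simpl ncode in H. unpair H. simpl in H.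
    apply Nat.eqb_eq in H. subst. constructor.
  - apply HD in H. unfold justified in H. simpl ncode in H. unpair H. simpl in H.
    destruct v as [|x v]; simpl in H; [discriminate|]. unpair H.
    apply Nat.eqb_eq in H. subst. constructor.
  - apply HD in H. unfold justified in H. simpl ncode in H. unpair H. simpl in H.
    apply fact_nth in H as [H ->]; auto. now constructor.
  - apply HD in H. unfold justified in H. rewrite ncode_comp in H. unpair H. simpl in H.
    apply bex_spec in H as (w & _ & H). apply andb_true_iff in H as [H1 H2].
    (* Nothing is known about the form of [w]; the facts of kind 1 decode it entry by entry along
       [gs]. *)
    assert (exists ws, w = nvec ws /\ evals gs v ws) as (ws & -> & Hws).
    { clear IHf H2. revert w H1. induction IHgs as [|g gs Hg _ IH]; intros w H1.
      - apply HD in H1. unfold justified in H1. simpl in H1. apply Nat.eqb_eq in H1.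
        exists []. subst. split; auto. constructor.
      - apply HD in H1. unfold justified in H1.
        change (ncodes (g :: gs)) with (S (pairing (ncode g) (ncodes gs))) in H1.
        simpl in H1. unpair H1.
        apply andb_true_iff in H1 as [H1 H2]. apply andb_true_iff in H1 as [H0 H1].
        apply andb_true_iff in H2 as [H2 H3]. apply IH in H3 as (ws & E & Hws).
        apply Nat.eqb_eq in H1. destruct w as [|w]; [discriminate|]. simpl in *.
        exists (pfst w :: ws). split.
        + simpl. rewrite <- E. now rewrite <- H1.
        + constructor; auto. }
    econstructor; eauto.
  - destruct v as [|n v].
    { apply HD in H. unfold justified in H. simpl ncode in H. unpair H. discriminate. }
    revert y H. induction n as [|n IHn]; intros y H;
      apply HD in H; unfold justified in H; simpl ncode in H; unpair H; simpl in H; unpair H.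
    + simpl in H. constructor. auto.
    + simpl in H. apply bex_spec in H as (r & _ & H). apply andb_true_iff in H as [H1 H2].
      apply ePrecS with r; [apply IHn|apply (IHg (n :: r :: v))]; assumption.
  - apply HD in H. unfold justified in H. simpl ncode in H. unpair H. simpl in H.
    apply andb_true_iff in H as [H1 H2]. constructor.
    + apply (IHf (y :: v)). exact H1.
    + intros m Hm. rewrite ball_spec in H2. specialize (H2 m Hm).
      apply bex_spec in H2 as (r & _ & Hr). exists r. apply (IHf (m :: v)). exact Hr.
Qed.

Definition sub_facts (D D' : nat) : Prop :=
  forall x, Nat.testbit D x = true -> Nat.testbit D' x = true.

(** [fact] occurs only positively, and a witness found below [D] stays below [D'] because it occurs
    in a fact of [D']. *)
Lemma justified_mono D D' k c v y : sub_facts D D' ->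
  justified D k c v y = true -> justified D' k c v y = true.
Proof.
  intros HS.
  assert (HF : forall k c v y, fact D k c v y = true -> fact D' k c v y = true)
    by (intros; apply HS; auto).
  unfold justified. destruct (k =? 0).
  - destruct (pfst c =? 0); auto. destruct (pfst c =? 1); auto.
    destruct (pfst c =? 2); auto. destruct (pfst c =? 3).
    + rewrite !bex_spec. intros (w & _ & H). apply andb_true_iff in H as [H1 H2].
      apply HF in H1, H2. exists w. rewrite H1, H2. split; auto. apply fact_lt in H1. tauto.
    + destruct (pfst c =? 4).
      * rewrite !andb_true_iff. intros [H H1]. split; auto.
        destruct (pfst (pred v) =? 0); auto. revert H1.
        rewrite !bex_spec. intros (w & _ & H1). apply andb_true_iff in H1 as [H1 H2].
        apply HF in H1, H2. exists w. rewrite H1, H2. split; auto. apply fact_lt in H1. tauto.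
      * rewrite !andb_true_iff, !ball_spec. intros [H H1]. split; auto.
        intros m Hm. specialize (H1 m Hm). revert H1. rewrite !bex_spec.
        intros (w & _ & H1). apply HF in H1. exists w. split; auto. apply fact_lt in H1. lia.
  - destruct (k =? 1).
    + destruct (c =? 0); auto. rewrite !andb_true_iff. intuition.
    + rewrite !andb_true_iff. intros [H1 H2]. split; auto. destruct (c =? 0); auto.
Qed.

(** A form of closure suited to building sets: each bit is presented as a quadruple, so that the
    projections in [closed_facts] are sure to decode it. *)
Definition good_facts (D : nat) : Prop :=
  forall x, Nat.testbit D x = true ->
    exists k c v y, x = pairing k (pairing c (pairing v y)) /\ justified D k c v y = true.

Lemma good_facts_closed D : good_facts D -> closed_facts D = true.
Proof.
  intros H. apply ball_spec. intros x _. destruct (Nat.testbit D x) eqn:E; auto.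
  destruct (H x E) as (k & c & v & y & -> & HJ). simpl.
  rewrite pfst_pairing, !psnd_pairing, !pfst_pairing. exact HJ.
Qed.

Lemma good_facts_union D1 D2 : good_facts D1 -> good_facts D2 ->
  exists D, good_facts D /\ sub_facts D1 D /\ sub_facts D2 D.
Proof.
  intros H1 H2. exists (Nat.lor D1 D2).
  assert (S1 : sub_facts D1 (Nat.lor D1 D2))
    by (intros x Hx; rewrite Nat.lor_spec, Hx; auto).
  assert (S2 : sub_facts D2 (Nat.lor D1 D2))
    by (intros x Hx; rewrite Nat.lor_spec, Hx; apply orb_true_r).
  split; [|auto].
  intros x Hx. rewrite Nat.lor_spec in Hx. apply orb_true_iff in Hx as [Hx|Hx].
  - destruct (H1 x Hx) as (k & c & v & y & -> & HJ). exists k, c, v, y. split; auto.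
    apply justified_mono with D1; auto.
  - destruct (H2 x Hx) as (k & c & v & y & -> & HJ). exists k, c, v, y. split; auto.
    apply justified_mono with D2; auto.
Qed.

Definition derivable (k c v y : nat) : Prop := exists D, good_facts D /\ fact D k c v y = true.

Lemma derivable_justified D k c v y :
  good_facts D -> justified D k c v y = true -> derivable k c v y.
Proof.
  intros HD HJ. set (x := pairing k (pairing c (pairing v y))).
  assert (S1 : sub_facts D (Nat.lor D (2 ^ x)))
    by (intros z Hz; rewrite Nat.lor_spec, Hz; auto).
  exists (Nat.lor D (2 ^ x)). split.
  - intros z Hz. rewrite Nat.lor_spec in Hz. apply orb_true_iff in Hz as [Hz|Hz].
    + destruct (HD z Hz) as (k' & c' & v' & y' & -> & HJ'). exists k', c', v', y'.
      split; auto. apply justified_mono with D; auto.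
    + rewrite Nat.pow2_bits_eqb in Hz. apply Nat.eqb_eq in Hz. subst z.
      exists k, c, v, y. split; auto. apply justified_mono with D; auto.
  - unfold fact. fold x. rewrite Nat.lor_spec, Nat.pow2_bits_true. apply orb_true_r.
Qed.

Lemma good_facts_0 : good_facts 0.
Proof. intros x Hx. rewrite Nat.bits_0 in Hx. discriminate. Qed.

Lemma derivable_nth v : forall i, i < length v -> derivable 2 i (nvec v) (nth i v 0).
Proof.
  induction v as [|x v IH]; intros i Hi; [simpl in Hi; lia|].
  destruct i as [|i].
  - apply derivable_justified with 0; [apply good_facts_0|].
    unfold justified. simpl. rewrite pfst_pairing. apply Nat.eqb_refl.
  - destruct (IH i) as (D & HD & HF); [simpl in Hi; lia|].
    apply derivable_justified with D; auto.
    unfold justified. simpl. rewrite psnd_pairing. auto.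
Qed.

Lemma eval_derivable c : forall v y, eval c v y -> derivable 0 (ncode c) (nvec v) y.
Proof.
  induction c as [| |i|f gs IHf IHgs|f g IHf IHg|f IHf] using code_ind_nested; intros v y H.
  - inversion H; subst. apply derivable_justified with 0; [apply good_facts_0|].
    unfold justified. simpl ncode. rewrite pfst_pairing. reflexivity.
  - inversion H; subst. apply derivable_justified with 0; [apply good_facts_0|].
    unfold justified. simpl ncode. rewrite pfst_pairing. simpl. rewrite pfst_pairing.
    apply Nat.eqb_refl.
  - inversion H; subst. destruct (derivable_nth v i) as (D & HD & HF); auto.
    apply derivable_justified with D; auto.
    unfold justified. simpl ncode. rewrite pfst_pairing, psnd_pairing. exact HF.
  - inversion H as [| | |f1 gs1 v1 ws y1 Hws Hf| | |]; subst.
    assert (derivable 1 (ncodes gs) (nvec v) (nvec ws)) as (D1 & HD1 & HF1).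
    { clear Hf H IHf. revert ws Hws. induction IHgs as [|g gs Hg _ IH]; intros ws Hws.
      - inversion Hws; subst. apply derivable_justified with 0; [apply good_facts_0|].
        reflexivity.
      - inversion Hws as [|g1 gs1 v1 z zs Hz Hzs]; subst.
        destruct (Hg _ _ Hz) as (D1 & HD1 & HF1).
        destruct (IH _ Hzs) as (D2 & HD2 & HF2).
        destruct (good_facts_union D1 D2) as (D & HD & S1 & S2); auto.
        apply derivable_justified with D; auto. apply S1 in HF1. apply S2 in HF2.
        unfold justified. simpl. rewrite !pfst_pairing, !psnd_pairing, Nat.eqb_refl. simpl.
        apply andb_true_iff. split; [exact HF1|exact HF2]. }
    destruct (IHf _ _ Hf) as (D2 & HD2 & HF2).
    destruct (good_facts_union D1 D2) as (D & HD & S1 & S2); auto.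
    apply derivable_justified with D; auto. apply S1 in HF1. apply S2 in HF2.
    unfold justified. rewrite ncode_comp, pfst_pairing, psnd_pairing, pfst_pairing, psnd_pairing.
    simpl. apply bex_spec. exists (nvec ws). split.
    + apply (fact_lt D 1 _ _ _ HF1).
    + apply andb_true_iff. split; [exact HF1|exact HF2].
  - destruct v as [|n v]; [inversion H|].
    revert y H. induction n as [|n IHn]; intros y H.
    + inversion H; subst. destruct (IHf v y) as (D & HD & HF); auto.
      apply derivable_justified with D; auto.
      unfold justified. simpl ncode. rewrite pfst_pairing, psnd_pairing, pfst_pairing, psnd_pairing.
      simpl. rewrite pfst_pairing, psnd_pairing. exact HF.
    + inversion H as [| | | | |f1 g1 n1 v1 r y1 Hr Hg|]; subst.
      destruct (IHn _ Hr) as (D1 & HD1 & HF1). destruct (IHg _ _ Hg) as (D2 & HD2 & HF2).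
      destruct (good_facts_union D1 D2) as (D & HD & S1 & S2); auto.
      apply derivable_justified with D; auto. apply S1 in HF1. apply S2 in HF2.
      unfold justified. simpl ncode. rewrite pfst_pairing, psnd_pairing, pfst_pairing, psnd_pairing.
      simpl. rewrite pfst_pairing, psnd_pairing. simpl.
      apply bex_spec. exists r. split.
      * apply (fact_lt D 0 _ _ _ HF1).
      * apply andb_true_iff. split; [exact HF1|exact HF2].
  - inversion H as [| | | | | |f1 v1 n1 H0 Hlt]; subst.
    (* A minimization has [y] premises besides the zero itself; their derivations are merged one at
       a time. *)
    assert (exists D, good_facts D /\ forall m, m < y ->
      exists r, fact D 0 (ncode f) (nvec (m :: v)) (S r) = true) as (D1 & HD1 & HF1).
    { clear H0 H. induction y as [|y IHy].
      - exists 0. split; [apply good_facts_0|]. intros; lia.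
      - destruct IHy as (D1 & HD1 & HF1); [auto|].
        destruct (Hlt y) as [r Hr]; [auto|].
        destruct (IHf _ _ Hr) as (D2 & HD2 & HF2).
        destruct (good_facts_union D1 D2) as (D & HD & S1 & S2); auto.
        exists D. split; auto. intros m Hm. destruct (Nat.eq_dec m y) as [->|Hne].
        + exists r. apply S2. exact HF2.
        + destruct (HF1 m) as [r' Hr']; [lia|]. exists r'. apply S1. exact Hr'. }
    destruct (IHf _ _ H0) as (D2 & HD2 & HF2).
    destruct (good_facts_union D1 D2) as (D & HD & S1 & S2); auto.
    apply derivable_justified with D; auto.
    unfold justified. simpl ncode. rewrite pfst_pairing, psnd_pairing. simpl.
    apply andb_true_iff. split; [apply S2; exact HF2|].
    apply ball_spec. intros m Hm. destruct (HF1 m Hm) as [r Hr]. apply S1 in Hr.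
    apply bex_spec. exists r. split; [|exact Hr].
    apply (fact_lt D 0 _ _ (S r)) in Hr. lia.
Qed.

(** Kleene's normal form: [fact_eval] is the soundness half and [eval_derivable] the completeness
    half. *)
Lemma univ_complete P : ce P -> exists e, forall n, P n <-> exists s, univ e n s = true.
Proof.
  intros [c Hc]. exists (ncode c). intros n. rewrite Hc. split.
  - intros [y Hy]. apply eval_derivable in Hy as (D & HD & HF). exists D.
    apply andb_true_iff. split; [now apply good_facts_closed|].
    apply bex_spec. exists y. split; auto. apply fact_lt in HF. tauto.
  - intros [D HD]. apply andb_true_iff in HD as [HD HF].
    apply bex_spec in HF as (y & _ & HF). exists y.
    apply (fact_eval D) with (v := [n]); auto. now apply closed_facts_sound.
Qed.

(** * Clopen approximations of open sets *)

Lemma mod_pow_mod n s m : n <= s -> (m mod 2 ^ s) mod 2 ^ n = m mod 2 ^ n.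
Proof.
  intros H. replace s with (n + (s - n)) by lia.
  rewrite Nat.pow_add_r, Nat.Div0.mod_mul_r, Nat.mul_comm, Nat.Div0.mod_add.
  apply Nat.Div0.mod_mod.
Qed.

(* A string of length [n] is coded by a number below [2^n], first bit least significant;
   [restr X n] codes the restriction of [X] to its first [n] bits. *)
Definition restr (X : cantor) (n : nat) : nat :=
  nat_rect (fun _ => nat) 0 (fun k r => r + Nat.b2n (X k) * 2 ^ k) n.

Lemma restr_lt X n : restr X n < 2 ^ n.
Proof. induction n as [|n IH]; simpl; [lia|]. destruct (X n); simpl; lia. Qed.

Lemma restr_mod X n s : n <= s -> restr X s mod 2 ^ n = restr X n.
Proof.
  intros H. induction H as [|s H IH].
  - apply Nat.mod_small, restr_lt.
  - simpl. replace s with ((s - n) + n) at 3 by lia.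
    rewrite Nat.pow_add_r, Nat.mul_assoc, Nat.Div0.mod_add. auto.
Qed.

Lemma restr_testbit m n : restr (Nat.testbit m) n = m mod 2 ^ n.
Proof.
  induction n as [|n IH]; [now rewrite Nat.mod_1_r|].
  simpl restr. rewrite IH, Nat.testbit_spec', Nat.pow_succ_r', (Nat.mul_comm 2).
  rewrite Nat.Div0.mod_mul_r. lia.
Qed.

Lemma restr_surj m n : m < 2 ^ n -> exists X, restr X n = m.
Proof. intros H. exists (Nat.testbit m). rewrite restr_testbit. now apply Nat.mod_small. Qed.

Lemma restr_shift X n : restr X (S n) = Nat.b2n (X 0) + 2 * restr (fun k => X (S k)) n.
Proof.
  induction n as [|n IH]; [simpl; lia|].
  change (restr X (S (S n))) with (restr X (S n) + Nat.b2n (X (S n)) * 2 ^ S n).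
  rewrite IH. simpl. lia.
Qed.

Fixpoint num (t : str) : nat :=
  match t with
  | [] => 0
  | b :: t => Nat.b2n b + 2 * num t
  end.

(** [str_code] is bijective base two: after adding 1, the binary digits of the code are those of
    [num t] with a leading 1. This is the origin of the terms [pred (2 ^ l + q)] below. *)
Lemma str_code_num t : str_code t + 1 = 2 ^ length t + num t.
Proof. induction t as [|b t IH]; simpl; [lia|]. destruct b; simpl; lia. Qed.

Lemma num_lt t : num t < 2 ^ length t.
Proof. induction t as [|b t IH]; simpl; [lia|]. destruct b; simpl; lia. Qed.

Lemma cyl_restr t : forall X, cyl t X <-> restr X (length t) = num t.
Proof.
  induction t as [|b t IH]; intros X.
  - split; auto. intros _ k Hk. simpl in Hk. lia.
  - simpl length. rewrite restr_shift. specialize (IH (fun k => X (S k))). simpl num. split.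
    + intros H. assert (E : X 0 = b) by (apply (H 0); simpl; lia).
      rewrite E. rewrite (proj1 IH); auto.
      intros k Hk. apply (H (S k)). simpl. lia.
    + intros H.
      assert (H0 : X 0 = b /\ restr (fun k => X (S k)) (length t) = num t)
        by (destruct (X 0), b; simpl in H; split; auto; lia).
      destruct H0 as [H0 H1]. apply IH in H1.
      intros [|k] Hk; [exact H0|]. apply (H1 k). simpl in Hk. lia.
Qed.

Definition take (n : nat) (X : cantor) : str := map X (seq 0 n).

Lemma length_take n X : length (take n X) = n.
Proof. unfold take. now rewrite length_map, length_seq. Qed.

Lemma cyl_take n X : cyl (take n X) X.
Proof.
  intros k Hk. rewrite length_take in Hk. unfold take.
  rewrite nth_indep with (d' := X 0) by now rewrite length_map, length_seq.
  rewrite map_nth, seq_nth; auto.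
Qed.

Lemma num_take n X : num (take n X) = restr X n.
Proof. pose proof (proj1 (cyl_restr _ _) (cyl_take n X)) as H. now rewrite length_take in H. Qed.

Lemma cyl_take_iff n X Y : cyl (take n X) Y <-> restr Y n = restr X n.
Proof. now rewrite cyl_restr, length_take, num_take. Qed.

(** * Compactness of Cantor space *)

Lemma konig (B : nat -> nat -> Prop) : B 0 0 ->
  (forall n m, m < 2 ^ n -> B n m -> B (S n) m \/ B (S n) (m + 2 ^ n)) ->
  exists X, forall n, B n (restr X n).
Proof.
  intros H0 HS.
  (* The path prefers the bit 0, decided classically. The new bit is the most significant one, so
     the two successors of [m] are [m] and [m + 2 ^ n]. *)
  set (P := nat_rect (fun _ => nat) 0 (fun n m =>
    if excluded_middle_informative (B (S n) m) then m else m + 2 ^ n)).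
  set (X := fun n => if excluded_middle_informative (B (S n) (P n)) then false else true).
  assert (E : forall n, restr X n = P n).
  { induction n as [|n IH]; auto. simpl. rewrite IH. unfold X. fold (P n).
    destruct excluded_middle_informative; simpl; lia. }
  exists X. induction n as [|n IH]; auto.
  destruct (HS n (restr X n) (restr_lt X n) IH) as [H|H].
  - rewrite E in *. simpl. fold (P n). destruct excluded_middle_informative; tauto.
  - rewrite E in *. simpl. fold (P n). destruct excluded_middle_informative; tauto.
Qed.

Lemma restr_split X n m : restr X n = m -> restr X (S n) = m \/ restr X (S n) = m + 2 ^ n.
Proof. intros <-. simpl. destruct (X n); simpl; lia. Qed.

(** If no stage works, the strings having for every stage an extension on which [Q] fails contain an
    infinite path: two stages refuting both successors would, by monotonicity, give a maximum
    refuting the string itself. *)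
Lemma compactness (Q : nat -> nat -> Prop) :
  (forall X s s', s <= s' -> Q s (restr X s) -> Q s' (restr X s')) ->
  (forall X, exists s, Q s (restr X s)) ->
  exists s, forall X, Q s (restr X s).
Proof.
  intros Hmono Hall. apply NNPP. intros Hno.
  destruct (konig (fun n m => forall s, exists X, restr X n = m /\ ~ Q s (restr X s))) as [X HX].
  - intros s. apply NNPP. intros H. apply Hno. exists s. intros X.
    apply NNPP. intros HQ. apply H. exists X. auto.
  - intros n m _ H. apply NNPP. intros Hn. apply not_or_and in Hn as [H1 H2].
    apply not_all_ex_not in H1 as [s1 H1]. apply not_all_ex_not in H2 as [s2 H2].
    destruct (H (max s1 s2)) as (X & HX & HQ).
    destruct (restr_split _ _ _ HX) as [E|E].
    + apply H1. exists X. split; auto. intros HQ'. apply HQ. revert HQ'. apply Hmono. lia.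
    + apply H2. exists X. split; auto. intros HQ'. apply HQ. revert HQ'. apply Hmono. lia.
  - destruct (Hall X) as [s Hs]. destruct (HX s s) as (Y & E & HQ).
    rewrite E in HQ. auto.
Qed.

(** * Counting strings of a fixed length *)

Lemma count_bound n p : count n p <= n.
Proof. induction n as [|n IH]; simpl; auto. destruct (p n); simpl; lia. Qed.

Lemma count_all n p : (forall m, m < n -> p m = true) -> count n p = n.
Proof.
  intros H. induction n as [|n IH]; simpl; auto. rewrite IH, H by auto. simpl. lia.
Qed.

Lemma count_pos n p m : m < n -> p m = true -> 1 <= count n p.
Proof.
  intros Hm Hp. apply Nat.leb_le. change (bex n p = true). apply bex_spec. eauto.
Qed.

Lemma count_add a b p : count (a + b) p = count a p + count b (fun m => p (a + m)).
Proof.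
  induction b as [|b IH]; simpl; [rewrite Nat.add_0_r; lia|].
  rewrite Nat.add_succ_r. simpl. lia.
Qed.

Lemma count_S n p : count (S n) p = count n p + Nat.b2n (p n).
Proof. reflexivity. Qed.

Lemma count_even_odd n p :
  count (2 * n) p = count n (fun m => p (2 * m)) + count n (fun m => p (1 + 2 * m)).
Proof.
  induction n as [|n IH]; auto.
  replace (2 * S n) with (S (S (2 * n))) by lia.
  rewrite !count_S, IH. change (1 + 2 * n) with (S (2 * n)). lia.
Qed.

(** Each string of length [n] has [2 ^ (s - n)] extensions of length [s]. *)
Lemma count_mod n s p : n <= s ->
  count (2 ^ s) (fun m => p (m mod 2 ^ n)) = 2 ^ (s - n) * count (2 ^ n) p.
Proof.
  intros H. induction H as [|s H IH].
  - rewrite Nat.sub_diag. simpl. rewrite Nat.add_0_r. apply count_ext.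
    intros i Hi. now rewrite Nat.mod_small.
  - replace (2 ^ S s) with (2 ^ s + 2 ^ s) by (simpl; lia).
    rewrite count_add. replace (S s - n) with (S (s - n)) by lia.
    rewrite (count_ext (2 ^ s) (fun m => p ((2 ^ s + m) mod 2 ^ n)) (fun m => p (m mod 2 ^ n))).
    + rewrite IH. simpl. lia.
    + intros m _. f_equal. replace s with ((s - n) + n) by lia.
      now rewrite Nat.pow_add_r, Nat.add_comm, Nat.Div0.mod_add.
Qed.

Lemma count_bex N i k (Q : nat -> nat -> bool) :
  (forall e, e < k -> count N (Q e) * 2 ^ (i + e + 1) <= N) ->
  count N (fun m => bex k (fun e => Q e m)) * 2 ^ i <= N.
Proof.
  intros H.
  (* The induction needs the exact partial sum of the geometric series: the union of the first [k]
     sets has proportion at most [2^-i * (1 - 2^-k)]. *)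
  enough (count N (fun m => bex k (fun e => Q e m)) * 2 ^ (i + k) + N <= N * 2 ^ k).
  { rewrite Nat.pow_add_r in H0. pose proof (Nat.pow_nonzero 2 k). nia. }
  induction k as [|k IH].
  - rewrite (count_ext N _ (fun _ => false)) by reflexivity.
    assert (E : count N (fun _ => false) = 0) by (clear; induction N; simpl; lia).
    rewrite E. simpl. lia.
  - specialize (IH (fun e He => H e (Nat.lt_lt_succ_r _ _ He))). specialize (H k ltac:(lia)).
    assert (Hle : count N (fun m => bex (S k) (fun e => Q e m)) <=
                  count N (fun m => bex k (fun e => Q e m)) + count N (Q k)).
    { clear IH H. induction N as [|N IHN]; simpl; auto.
      destruct (bex (S k) (fun e => Q e N)) eqn:E; simpl; [|lia].
      apply bex_spec in E as (e & He & E).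
      destruct (Nat.eq_dec e k) as [->|Hne]; [rewrite E; simpl; lia|].
      replace (bex k (fun e => Q e N)) with true; [simpl; lia|].
      symmetry. apply bex_spec. exists e. split; auto. lia. }
    replace (i + k + 1) with (S (i + k)) in H by lia.
    replace (i + S k) with (S (i + k)) by lia.
    rewrite Nat.pow_succ_r' in *. rewrite (Nat.pow_succ_r' 2 k).
    nia.
Qed.

Lemma length_filter_strs n : forall (f : str -> bool) p,
  (forall t, length t = n -> f t = p (num t)) ->
  length (filter f (strs n)) = count (2 ^ n) p.
Proof.
  induction n as [|n IH]; intros f p H.
  - simpl. rewrite H by auto. simpl. now destruct (p 0).
  - assert (E : forall b l, length (filter f (map (cons b) l)) = length (filter (fun t => f (b :: t)) l)).
    { intros b l. induction l as [|t l IHl]; simpl; auto. destruct (f (b :: t)); simpl; auto. }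
    simpl strs. rewrite filter_app, length_app, !E.
    rewrite (IH _ (fun m => p (2 * m))), (IH _ (fun m => p (1 + 2 * m))).
    + rewrite Nat.pow_succ_r', count_even_odd. reflexivity.
    + intros t Ht. rewrite H; auto. simpl. auto.
    + intros t Ht. rewrite H; auto. simpl. auto.
Qed.

(** * Measure and effective openness by stages *)

Definition coverb (n : nat) (U : cantor -> Prop) (m : nat) : bool :=
  if excluded_middle_informative (forall X, restr X n = m -> U X) then true else false.

Lemma coverb_spec n U m : coverb n U m = true <-> forall X, restr X n = m -> U X.
Proof. unfold coverb. destruct excluded_middle_informative; split; auto; discriminate. Qed.

Lemma cnt_count n U : cnt n U = count (2 ^ n) (coverb n U).
Proof.
  apply length_filter_strs. intros t Ht. unfold coverb.
  assert (E : subset_c (cyl t) U <-> forall X, restr X n = num t -> U X).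
  { subst n. split; intros H X HX; apply H, cyl_restr; auto. }
  destruct excluded_middle_informative, excluded_middle_informative; tauto.
Qed.

(** Clearing denominators removes the supremum and the reals; all later measure estimates are
    inequalities between natural numbers. *)
Lemma lambda_le_iff U i :
  Rbar_le (lambda_open U) (Finite (/ 2 ^ i)) <-> forall n, cnt n U * 2 ^ i <= 2 ^ n.
Proof.
  assert (E : forall n, (INR (cnt n U) / 2 ^ n <= / 2 ^ i)%R <-> cnt n U * 2 ^ i <= 2 ^ n).
  { intros n.
    assert (P : forall k, (0 < 2 ^ k)%R) by (intros; apply pow_lt; lra).
    assert (I : forall k, INR (2 ^ k) = (2 ^ k)%R)
      by (intros; rewrite pow_INR; f_equal; simpl; lra).
    pose proof (P n) as Pn. pose proof (P i) as Pi. split; intros H.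
    - apply INR_le. rewrite mult_INR, !I.
      apply (Rmult_le_compat_r (2 ^ n * 2 ^ i)) in H; [|nra].
      replace (INR (cnt n U) / 2 ^ n * (2 ^ n * 2 ^ i))%R with (INR (cnt n U) * 2 ^ i)%R in H
        by (field; lra).
      replace (/ 2 ^ i * (2 ^ n * 2 ^ i))%R with (2 ^ n)%R in H by (field; lra). exact H.
    - apply le_INR in H. rewrite mult_INR, !I in H.
      apply (Rmult_le_reg_r (2 ^ n * 2 ^ i)); [nra|].
      replace (INR (cnt n U) / 2 ^ n * (2 ^ n * 2 ^ i))%R with (INR (cnt n U) * 2 ^ i)%R
        by (field; lra).
      replace (/ 2 ^ i * (2 ^ n * 2 ^ i))%R with (2 ^ n)%R by (field; lra). exact H. }
  pose proof (is_sup_seq_lub _ _ (Sup_seq_correct (fun n => Finite (INR (cnt n U) / 2 ^ n)))) as [Hub Hlub].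
  fold (lambda_open U) in Hub, Hlub. split.
  - intros H n. apply E.
    change (Rbar_le (Finite (INR (cnt n U) / 2 ^ n)) (Finite (/ 2 ^ i))).
    eapply Rbar_le_trans; [|exact H]. apply Hub. exists n. reflexivity.
  - intros H. apply Hlub. intros x [n ->]. simpl. apply E, H.
Qed.

(** Stage [s] looks at [s] bits only, so each stage is clopen and is measured by [count (2 ^ s)]. *)
Definition stage_set (R : nat -> nat -> bool) : cantor -> Prop :=
  fun X => exists s, R s (restr X s) = true.

Definition upto (R : nat -> nat -> bool) (s m : nat) : bool :=
  bex (S s) (fun s' => R s' (m mod 2 ^ s')).

Lemma upto_restr R X s : upto R s (restr X s) = true <-> exists s', s' <= s /\ R s' (restr X s') = true.
Proof.
  unfold upto. rewrite bex_spec. split; intros (s' & H & HR); exists s'.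
  - rewrite restr_mod in HR by lia. split; auto; lia.
  - rewrite restr_mod by lia. split; auto; lia.
Qed.

Lemma upto_mono R X s s' : s <= s' ->
  upto R s (restr X s) = true -> upto R s' (restr X s') = true.
Proof.
  rewrite !upto_restr. intros H (s0 & H0 & HR). exists s0. split; auto. lia.
Qed.

Lemma stage_set_upto R X : stage_set R X <-> exists s, upto R s (restr X s) = true.
Proof.
  split.
  - intros [s H]. exists s. apply upto_restr. eauto.
  - intros [s H]. apply upto_restr in H as (s' & _ & H). exists s'. auto.
Qed.

Lemma stage_set_cover R n m : (forall X, restr X n = m -> stage_set R X) <->
  exists s, n <= s /\ forall X, restr X n = m -> upto R s (restr X s) = true.
Proof.
  split.
  - intros H.
    (* Including [n <= s] ensures that the uniform stage sees the whole prefix of length [n];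
       outside the cylinder the implication is vacuous. *)
    destruct (compactness (fun s x => n <= s /\ (x mod 2 ^ n = m -> upto R s x = true))) as [s Hs].
    + intros X s s' Hle [H1 H2]. split; [lia|].
      intros HX. rewrite restr_mod in HX by lia. rewrite restr_mod in H2 by lia.
      apply (upto_mono R X s s'); auto.
    + intros X. destruct (classic (restr X n = m)) as [HX|HX].
      * apply H in HX. apply stage_set_upto in HX as [s HX].
        exists (max n s). split; [lia|]. intros _. apply (upto_mono R X s); auto. lia.
      * exists n. split; auto. rewrite restr_mod by auto. tauto.
    + exists s. split; [apply (Hs (fun _ => false))|].
      intros X HX. apply Hs. rewrite restr_mod; auto. apply (Hs X).
  - intros (s & _ & H) X HX. apply stage_set_upto. eauto.
Qed.

(** By compactness, a cylinder inside the open set is exhausted at some finite stage, and inspecting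
    all strings of that length detects this. *)
Lemma stage_set_unif_eff_open (R : nat -> nat -> nat -> bool) :
  computableb 3 (fun v => R (nth 0 v 0) (nth 1 v 0) (nth 2 v 0)) ->
  unif_eff_open (fun i => stage_set (R i)).
Proof.
  intros HR. split.
  - intros i X [s Hs]. exists (take s X). split; [apply cyl_take|].
    intros Y HY. apply cyl_take_iff in HY. exists s. now rewrite HY.
  - apply (ce_of_decidable (fun s n =>
      bex (S s) (fun i => bex (S s) (fun l => bex (2 ^ l) (fun q =>
        (n =? pairing i (pred (2 ^ l + q))) &&
        ball (2 ^ s) (fun m => negb (m mod 2 ^ l =? q) ||
          bex (S s) (fun s' => R i s' (m mod 2 ^ s')))))))).
    + assert (HR' : forall k a b c, computable k a -> computable k b -> computable k c ->
        computableb k (fun v => R (a v) (b v) (c v))).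
      { intros. apply (computable_app3 k (fun a b c => Nat.b2n (R a b c))); auto. }
      computable_auto.
    + intros n. split.
      * intros (i & t & -> & H). unfold enc.
        assert (HE : str_code t = pred (2 ^ length t + num t)) by (pose proof (str_code_num t); lia).
        assert (H1 : forall X, restr X (length t) = num t -> stage_set (R i) X)
          by (intros X HX; apply H, cyl_restr; auto).
        apply stage_set_cover in H1 as (s & Hs & H1).
        (* The search for the index is bounded by the stage, so the stage must be at least [i]. *)
        exists (max s i). apply bex_spec. exists i. split; [lia|].
        apply bex_spec. exists (length t). split; [lia|].
        apply bex_spec. exists (num t). split; [apply num_lt|].
        rewrite HE, Nat.eqb_refl. simpl.
        apply ball_spec. intros m Hm.
        destruct (Nat.eqb_spec (m mod 2 ^ length t) (num t)) as [Em|]; auto. simpl.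
        destruct (restr_surj m (max s i) Hm) as [X HX]. rewrite <- HX.
        apply (upto_mono (R i) X s); [lia|]. apply H1.
        rewrite <- Em, <- HX, restr_mod; auto. lia.
      * intros [s H]. apply bex_spec in H as (i & _ & H). apply bex_spec in H as (l & Hl & H).
        apply bex_spec in H as (q & Hq & H). apply andb_true_iff in H as [Hn H].
        apply Nat.eqb_eq in Hn. destruct (restr_surj q l Hq) as [Z HZ].
        exists i, (take l Z). split.
        { unfold enc. rewrite Hn. f_equal. pose proof (str_code_num (take l Z)) as E.
          rewrite length_take, num_take, HZ in E. lia. }
        intros X HX. apply cyl_take_iff in HX. rewrite HZ in HX.
        apply stage_set_upto. exists s. rewrite ball_spec in H.
        specialize (H (restr X s) (restr_lt X s)). rewrite restr_mod, HX, Nat.eqb_refl in H by lia.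
        exact H.
Qed.

(** Compactness puts all cylinders of length [n] that lie in [U] into a single stage, where the
    bound is known. *)
Lemma lambda_stage_le (P : nat -> nat -> bool) (U : cantor -> Prop) i :
  (forall X s s', s <= s' -> P s (restr X s) = true -> P s' (restr X s') = true) ->
  (forall X, U X -> exists s, P s (restr X s) = true) ->
  (forall s, count (2 ^ s) (P s) * 2 ^ i <= 2 ^ s) ->
  Rbar_le (lambda_open U) (Finite (/ 2 ^ i)).
Proof.
  intros Hmono HU Hc. apply lambda_le_iff. intros n. rewrite cnt_count.
  destruct (compactness (fun s x => n <= s /\ (coverb n U (x mod 2 ^ n) = true -> P s x = true)))
    as [s Hs].
  - intros X s s' Hle [H1 H2]. split; [lia|].
    rewrite restr_mod in * by lia. intros H. apply (Hmono X s); auto.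
  - intros X. destruct (classic (U X)) as [HX|HX].
    + destruct (HU X HX) as [s Hs]. exists (max n s). split; [lia|].
      intros _. apply (Hmono X s); auto. lia.
    + exists n. split; auto. rewrite restr_mod, coverb_spec by auto. intros H. exfalso. eauto.
  - assert (Hns : n <= s) by apply (Hs (fun _ => false)).
    assert (Hle : count (2 ^ s) (fun m => coverb n U (m mod 2 ^ n)) <= count (2 ^ s) (P s)).
    { apply count_le. intros m Hm. destruct (restr_surj m s Hm) as [X <-]. apply Hs. }
    rewrite count_mod in Hle by auto. specialize (Hc s).
    replace s with (n + (s - n)) in Hc at 3 by lia. rewrite Nat.pow_add_r in Hc.
    pose proof (Nat.pow_nonzero 2 (s - n)). nia.
Qed.

Lemma count_le_of_lambda (P : nat -> bool) (U : cantor -> Prop) i s :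
  Rbar_le (lambda_open U) (Finite (/ 2 ^ i)) ->
  (forall X, P (restr X s) = true -> U X) ->
  count (2 ^ s) P * 2 ^ i <= 2 ^ s.
Proof.
  intros H HP. apply lambda_le_iff with (n := s) in H. rewrite cnt_count in H.
  assert (count (2 ^ s) P <= count (2 ^ s) (coverb s U)); [|nia].
  apply count_le. intros m _ Hm. apply coverb_spec. intros X HX. apply HP. now rewrite HX.
Qed.

(** * The universal test and its modification *)

(** Program [e] is read as an enumeration of pairs [enc i t]; the prefix of length [l] of the string
    [m] has the code [pred (2 ^ l + m mod 2 ^ l)]. *)
Definition covered (e i s m : nat) : bool :=
  bex (S s) (fun l => bex (S s) (fun u =>
    univ e (pairing i (pred (2 ^ l + m mod 2 ^ l))) u)).

Lemma covered_restr e i s X : covered e i s (restr X s) = true <->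
  exists l u, l <= s /\ u <= s /\ univ e (enc i (take l X)) u = true.
Proof.
  assert (E : forall l, l <= s -> pairing i (pred (2 ^ l + restr X s mod 2 ^ l)) = enc i (take l X)).
  { intros l Hl. unfold enc. f_equal. pose proof (str_code_num (take l X)) as E.
    rewrite length_take, num_take in E. rewrite restr_mod by auto. lia. }
  unfold covered. rewrite bex_spec. split.
  - intros (l & Hl & H). apply bex_spec in H as (u & Hu & H).
    rewrite E in H by lia. exists l, u. repeat split; auto; lia.
  - intros (l & u & Hl & Hu & H). exists l. split; [lia|].
    apply bex_spec. exists u. rewrite E by lia. split; auto. lia.
Qed.

Lemma covered_mono e i X s s' : s <= s' ->
  covered e i s (restr X s) = true -> covered e i s' (restr X s') = true.
Proof.
  rewrite !covered_restr. intros Hs (l & u & Hl & Hu & H). exists l, u. repeat split; auto; lia.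
Qed.

Lemma unif_eff_open_covered U : unif_eff_open U ->
  exists e, forall i X, U i X <-> exists s, covered e i s (restr X s) = true.
Proof.
  intros [Hopen Hce]. apply univ_complete in Hce as [e He]. exists e. intros i X. split.
  - intros HX. destruct (Hopen i X HX) as (t & Ht & HU).
    destruct (proj1 (He (enc i (take (length t) X)))) as [u Hu].
    + exists i, (take (length t) X). split; auto. intros Y HY. apply HU, cyl_restr.
      apply cyl_take_iff in HY. rewrite HY. now apply cyl_restr.
    + exists (max (length t) u). apply covered_restr. exists (length t), u.
      repeat split; auto; lia.
  - intros [s H]. apply covered_restr in H as (l & u & _ & _ & H).
    destruct (proj2 (He (enc i (take l X)))) as (i' & t & E & HU); [eauto|].
    apply pairing_inj in E as [<- E]. apply HU.
    assert (Et : t = take l X).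
    { pose proof (str_code_num t). pose proof (str_code_num (take l X)).
      pose proof (num_lt t). pose proof (num_lt (take l X)).
      (* [str_code t + 1] is at least [2 ^ length t] and less than twice that, so the code
         determines the length. *)
      assert (Hl : length t = length (take l X)).
      { destruct (lt_eq_lt_dec (length t) (length (take l X))) as [[Hl|Hl]|Hl]; auto; exfalso;
          apply (Nat.pow_le_mono_r 2) in Hl; simpl in Hl; lia. }
      clear - E Hl. revert E Hl. generalize (take l X). intros t'. revert t'.
      induction t as [|b t IH]; intros [|b' t'] E Hl; try discriminate; auto.
      simpl in E, Hl. f_equal; [destruct b, b'; auto; lia|].
      apply IH; [destruct b, b'; lia|lia]. }
    rewrite Et. apply cyl_take.
Qed.

Definition small (e i s : nat) : bool := count (2 ^ s) (covered e i s) * 2 ^ i <=? 2 ^ s.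

(** The usual truncation: a stage counts only if the measure enumerated by then respects the bound,
    so every index yields a legal component. *)
Definition trimmed (e i : nat) : nat -> nat -> bool :=
  upto (fun s m => small e i s && covered e i s m).

(** At a small stage, all that was accepted so far lies in the current [covered], whose measure has
    been checked; at any other stage nothing is added and the proportion does not grow. *)
Lemma count_trimmed e i s : count (2 ^ s) (trimmed e i s) * 2 ^ i <= 2 ^ s.
Proof.
  assert (H : forall s, small e i s = true -> count (2 ^ s) (trimmed e i s) * 2 ^ i <= 2 ^ s).
  { clear s. intros s Hs. apply Nat.leb_le in Hs.
    assert (count (2 ^ s) (trimmed e i s) <= count (2 ^ s) (covered e i s)); [|nia].
    apply count_le. intros m Hm Ht. destruct (restr_surj m s Hm) as [X <-].
    apply upto_restr in Ht as (s' & Hs' & Ht). apply andb_true_iff in Ht as [_ Ht].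
    now apply covered_mono with s'. }
  induction s as [|s IH].
  - simpl. lia.
  - destruct (small e i (S s)) eqn:E; auto.
    assert (Hle : count (2 ^ S s) (trimmed e i (S s)) <=
                  count (2 ^ S s) (fun m => trimmed e i s (m mod 2 ^ s))).
    { apply count_le. intros m Hm Ht. destruct (restr_surj m (S s) Hm) as [X <-].
      apply upto_restr in Ht as (s' & Hs' & Ht). rewrite restr_mod by lia.
      apply upto_restr. exists s'. split; auto.
      destruct (Nat.eq_dec s' (S s)) as [->|]; [|lia]. rewrite E in Ht. discriminate. }
    rewrite count_mod in Hle by lia. replace (S s - s) with 1 in Hle by lia.
    rewrite Nat.pow_succ_r' in *. simpl (2 ^ 1) in Hle. nia.
Qed.

(** Level [i] takes component [i + e + 1] of program [e], so that the measure bounds sum to at most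
    [2^-i]. *)
Definition ustage (i s m : nat) : bool := bex s (fun e => trimmed e (i + e + 1) s m).

Lemma count_ustage i s : count (2 ^ s) (ustage i s) * 2 ^ i <= 2 ^ s.
Proof. apply count_bex. intros e _. apply count_trimmed. Qed.

Lemma ustage_mono i X s s' : s <= s' ->
  ustage i s (restr X s) = true -> ustage i s' (restr X s') = true.
Proof.
  unfold ustage. rewrite !bex_spec. intros Hs (e & He & H). exists e. split; [lia|].
  revert H. now apply upto_mono.
Qed.

Lemma computableb_ustage k a b c : computable k a -> computable k b -> computable k c ->
  computableb k (fun v => ustage (a v) (b v) (c v)).
Proof.
  assert (Hc : forall k a b c d, computable k a -> computable k b -> computable k c ->
    computable k d -> computableb k (fun v => covered (a v) (b v) (c v) (d v))).
  { clear. intros k a b c d. apply (computable_app4 k (fun a b c d => Nat.b2n (covered a b c d))).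
    change (computableb 4 (fun v => covered (nth 0 v 0) (nth 1 v 0) (nth 2 v 0) (nth 3 v 0))).
    unfold covered. computable_auto. }
  apply (computable_app3 k (fun a b c => Nat.b2n (ustage a b c))).
  change (computableb 3 (fun v => ustage (nth 0 v 0) (nth 1 v 0) (nth 2 v 0))).
  unfold ustage, trimmed, upto, small. computable_auto.
Qed.
#[local] Hint Resolve computableb_ustage : computable.

Definition utest (i : nat) : cantor -> Prop := stage_set (ustage i).

Lemma lambda_utest i : Rbar_le (lambda_open (utest i)) (Finite (/ 2 ^ i)).
Proof.
  apply lambda_stage_le with (ustage i); auto using count_ustage.
  intros X s s'. apply ustage_mono.
Qed.

(** For an index of a genuine test every stage is small, so truncation removes nothing. *)
Lemma utest_universal V : ML_test V -> subset_c (bigcap_c V) (bigcap_c utest).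
Proof.
  intros [HV HL]. destruct (unif_eff_open_covered V HV) as [e He]. intros X HX i.
  destruct (proj1 (He (i + e + 1) X) (HX _)) as [s Hs].
  exists (max s (S e)). apply bex_spec. exists e. split; [lia|].
  apply upto_restr. exists s. split; [lia|]. rewrite Hs, andb_true_r.
  apply Nat.leb_le. apply count_le_of_lambda with (V (i + e + 1)); auto.
  intros Y HY. apply He. eauto.
Qed.

(** * The strings [tau s] and their accumulation point *)

Definition tau (s : nat) : nat := least (2 ^ s) (fun m => negb (ustage 1 s m)).

(** A string outside stage [s] exists because [utest 1] has measure at most one half at every
    stage. *)
Lemma tau_spec s : tau s < 2 ^ s /\ ustage 1 s (tau s) = false.
Proof.
  rewrite <- negb_true_iff. apply (least_ex (2 ^ s) (fun m => negb (ustage 1 s m))).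
  apply NNPP. intros Hn. pose proof (count_ustage 1 s) as H.
  rewrite count_all in H.
  - pose proof (Nat.pow_nonzero 2 s). simpl in H. lia.
  - intros m Hm. destruct (ustage 1 s m) eqn:E; auto.
    exfalso. apply Hn. exists m. rewrite E. auto.
Qed.

Lemma computable_tau k a : computable k a -> computable k (fun v => tau (a v)).
Proof. apply (computable_app1 k tau). unfold tau. computable_auto. Qed.
#[local] Hint Resolve computable_tau : computable.

(** If a string is a prefix of [tau s] for arbitrarily large [s], then so is one of its two one-bit
    extensions. *)
Lemma tau_accumulation : exists X, forall n N, exists s, N <= s /\ tau s mod 2 ^ n = restr X n.
Proof.
  destruct (konig (fun n m => forall N, exists s, N <= s /\ tau s mod 2 ^ n = m)) as [X HX].
  - intros N. exists N. split; [auto|apply Nat.mod_1_r].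
  - intros n m _ H. apply NNPP. intros Hn. apply not_or_and in Hn as [H1 H2].
    apply not_all_ex_not in H1 as [N1 H1]. apply not_all_ex_not in H2 as [N2 H2].
    destruct (H (max N1 N2)) as (s & Hs & E). rewrite <- restr_testbit in E.
    apply restr_split in E. rewrite restr_testbit in E. destruct E as [E|E].
    + apply H1. exists s. split; auto. lia.
    + apply H2. exists s. split; auto. lia.
  - exists X. auto.
Qed.

(** The cylinder of [tau n] has measure [2^-n]; the union bound runs over [n = j + e + 1]. At stage
    [s] only cylinders with [n <= s] are decided by the available bits. *)
Lemma lambda_tau_tail U j : (forall X, U X -> exists n, j < n /\ restr X n = tau n) ->
  Rbar_le (lambda_open U) (Finite (/ 2 ^ j)).
Proof.
  intros HU.
  apply lambda_stage_le with (fun s m => bex s (fun e =>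
    (j + e + 1 <=? s) && (m mod 2 ^ (j + e + 1) =? tau (j + e + 1)))).
  - intros X s s' Hs. rewrite !bex_spec. intros (e & He & H). exists e. split; [lia|].
    apply andb_true_iff in H as [H1 H]. apply Nat.leb_le in H1.
    apply andb_true_iff. rewrite Nat.leb_le. split; [lia|].
    rewrite restr_mod in * by lia. auto.
  - intros X HX. destruct (HU X HX) as (n & Hn & E). exists n.
    apply bex_spec. exists (n - j - 1). split; [lia|].
    replace (j + (n - j - 1) + 1) with n by lia.
    rewrite restr_mod, E, Nat.leb_refl, Nat.eqb_refl; auto.
  - intros s. apply (count_bex (2 ^ s) j s (fun e m =>
      (j + e + 1 <=? s) && (m mod 2 ^ (j + e + 1) =? tau (j + e + 1)))).
    intros e _. set (n := j + e + 1). destruct (Nat.leb_spec n s) as [Hn|Hn]; simpl.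
    + rewrite (count_mod n s (fun m => m =? tau n)) by auto.
      assert (H : forall N, count N (fun m => m =? tau n) <= if tau n <? N then 1 else 0).
      { induction N as [|N IH]; auto. rewrite count_S.
        destruct (Nat.ltb_spec (tau n) N), (Nat.ltb_spec (tau n) (S N)), (Nat.eqb_spec N (tau n));
          simpl; lia. }
      specialize (H (2 ^ n)). destruct (tau n <? 2 ^ n).
      all: replace s with (s - n + n) at 2 by lia; rewrite Nat.pow_add_r; nia.
    + assert (E : forall N, count N (fun _ => false) = 0) by (induction N; simpl; lia).
      rewrite E. lia.
Qed.

(** * The effectively measurable set and the modified test *)

Definition hit (M n m : nat) : bool := (M <=? n) && (m mod 2 ^ n =? tau n).

Lemma hit_spec M n m : hit M n m = true <-> M <= n /\ m mod 2 ^ n = tau n.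
Proof. unfold hit. now rewrite andb_true_iff, Nat.leb_le, Nat.eqb_eq. Qed.

Lemma computableb_hit k a b c : computable k a -> computable k b -> computable k c ->
  computableb k (fun v => hit (a v) (b v) (c v)).
Proof. unfold hit. computable_auto. Qed.
#[local] Hint Resolve computableb_hit : computable.

Definition tau_union (M : nat) : cantor -> Prop := stage_set (hit M).

Lemma tau_union_spec M X : tau_union M X <-> exists n, M <= n /\ restr X n = tau n.
Proof.
  split; intros [n H]; exists n.
  - now rewrite hit_spec, restr_mod in H.
  - now rewrite hit_spec, restr_mod.
Qed.

(** This is the test that a random point must fail to meet at some level, which will supply [M]. The
    shift by one turns [S j <= n] into the tail [j < n]. *)
Lemma tau_union_ML_test : ML_test (fun j => tau_union (S j)).
Proof.
  split.
  - apply (stage_set_unif_eff_open (fun j => hit (S j))). computable_auto.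
  - intros j. apply lambda_tau_tail. intros X HX. now apply tau_union_spec in HX.
Qed.

Lemma tau_union_eff_measurable M : eff_measurable (tau_union M).
Proof.
  (* The outer approximation is the set itself. [R i] describes the clopen complement of its
     cylinders of length at most [i]; the overlap lies in the tail beyond [i]. *)
  set (R := fun i s m => (i <=? s) && ball (S i) (fun n => negb (hit M n m))).
  exists (fun _ => tau_union M), (fun i => stage_set (R i)). split; [|split].
  - apply (stage_set_unif_eff_open (fun _ => hit M)). computable_auto.
  - apply stage_set_unif_eff_open. unfold R. computable_auto.
  - intros i. split; [|split].
    + intros X HX. apply tau_union_spec. apply NNPP. intros Hn. apply HX.
      exists i. unfold R. rewrite Nat.leb_refl. apply ball_spec. intros n Hi.
      apply negb_true_iff. destruct (hit M n (restr X i)) eqn:E; auto.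
      exfalso. apply Hn. exists n. now rewrite hit_spec, restr_mod in E by lia.
    + intros X HX. exact HX.
    + apply lambda_tau_tail. intros X [HA [s HV]].
      apply tau_union_spec in HA as (n & HM & E). exists n. split; auto.
      apply andb_true_iff in HV as [Hs HV]. apply Nat.leb_le in Hs.
      destruct (le_lt_dec n i) as [Hn|]; auto.
      rewrite ball_spec in HV. specialize (HV n ltac:(lia)).
      rewrite negb_true_iff in HV. exfalso. revert HV.
      rewrite (proj2 (hit_spec M n (restr X s))); [discriminate|].
      rewrite restr_mod by lia. auto.
Qed.

(** Hits are sought up to stage [s] only, which keeps the predicate decidable. For a point with
    first hit [n], only [ustage (S n)] can act from stage [n] on. *)
Definition wstage (M i s m : nat) : bool :=
  if i =? 0 then
    bex (S s) (fun n => hit M n m && ball n (fun n' => negb (hit M n' m)) && ustage (S n) s m)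
    || ball (S s) (fun n => negb (hit M n m)) && ustage 1 s m
  else ustage i s m.

Definition wtest (M i : nat) : cantor -> Prop := stage_set (wstage M i).

Lemma wtest_0_spec M X : wtest M 0 X <->
  (exists n s, n <= s /\ (M <= n /\ restr X n = tau n) /\
     (forall n', n' < n -> M <= n' -> restr X n' <> tau n') /\ ustage (S n) s (restr X s) = true) \/
  (exists s, (forall n, n <= s -> M <= n -> restr X n <> tau n) /\ ustage 1 s (restr X s) = true).
Proof.
  assert (H : forall k s, k <= S s -> ball k (fun n => negb (hit M n (restr X s))) = true <->
    forall n, n < k -> M <= n -> restr X n <> tau n).
  { intros k s Hk. rewrite ball_spec. split.
    - intros H n Hn HM E. specialize (H n Hn). apply negb_true_iff in H.
      rewrite (proj2 (hit_spec M n _)) in H; [discriminate|]. rewrite restr_mod by lia. auto.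
    - intros H n Hn. apply negb_true_iff. destruct (hit M n (restr X s)) eqn:E; auto.
      apply hit_spec in E as [HM E]. rewrite restr_mod in E by lia. exfalso. now apply (H n). }
  unfold wtest, stage_set, wstage. simpl. split.
  - intros [s Hs]. apply orb_true_iff in Hs as [Hs|Hs].
    + left. apply bex_spec in Hs as (n & Hn & Hs). apply andb_true_iff in Hs as [Hs Hu].
      apply andb_true_iff in Hs as [Hh Hb]. apply hit_spec in Hh. rewrite restr_mod in Hh by lia.
      rewrite H in Hb by lia. exists n, s. repeat split; try tauto; lia.
    + right. apply andb_true_iff in Hs as [Hb Hu]. rewrite H in Hb by lia. exists s.
      split; auto. intros n Hn. apply Hb. lia.
  - intros [(n & s & Hn & Hh & Hb & Hu)|(s & Hb & Hu)]; exists s; apply orb_true_iff.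
    + left. apply bex_spec. exists n. split; [lia|].
      rewrite Hu, andb_true_r. apply andb_true_iff. split; [|apply H; auto; lia].
      apply hit_spec. rewrite restr_mod by lia. exact Hh.
    + right. rewrite Hu, andb_true_r. apply H; auto. intros n Hn. apply Hb. lia.
Qed.

(** Level 0 needs only measure at most 1. A point of all [utest i] enters it through [utest (k + 1)]
    if [k] is its first hit, and through [utest 1] if it has none. *)
Lemma wtest_universal M : universal_ML_test (wtest M).
Proof.
  split; [split|].
  - apply (stage_set_unif_eff_open (wstage M)). unfold wstage. computable_auto.
  - intros [|i].
    + apply lambda_le_iff. intros n. rewrite cnt_count. simpl.
      pose proof (count_bound (2 ^ n) (coverb n (wtest M 0))). lia.
    + apply lambda_utest.
  - intros V HV X HX. apply (utest_universal V HV) in HX. intros [|i]; [|apply HX].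
    apply wtest_0_spec. destruct (classic (exists n, M <= n /\ restr X n = tau n)) as [[n Hn]|Hno].
    + left. destruct (least_ex (S n) (fun n => hit M n (restr X n))) as [_ Hk].
      { exists n. split; auto. apply hit_spec. rewrite restr_mod; auto. }
      pose proof (least_min (S n) (fun n => hit M n (restr X n))) as Hmin.
      set (k := least _ _) in *. destruct (HX (S k)) as [s Hs].
      exists k, (max k s). rewrite hit_spec, restr_mod in Hk by auto.
      split; [lia|]. split; [exact Hk|]. split.
      * intros n' Hn' HM E. specialize (Hmin n' Hn'). cbv beta in Hmin.
        rewrite (proj2 (hit_spec M n' _)) in Hmin; [discriminate|]. rewrite restr_mod; auto.
      * apply ustage_mono with s; auto. lia.
    + right. destruct (HX 1) as [s Hs]. exists s. split; auto.
      intros n _ HM E. apply Hno. eauto.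
Qed.

(** * Refuting layerwise decidability *)

Lemma tau_cylinder_not_covered n : exists Y, restr Y n = tau n /\ ~ utest (S n) Y.
Proof.
  apply NNPP. intros Hno.
  pose proof (count_le_of_lambda (fun m => m =? tau n) _ _ n (lambda_utest (S n))) as H.
  assert (H1 : 1 <= count (2 ^ n) (fun m => m =? tau n)).
  { apply count_pos with (tau n); [apply tau_spec|apply Nat.eqb_refl]. }
  rewrite Nat.pow_succ_r' in H. pose proof (Nat.pow_nonzero 2 n).
  enough (count (2 ^ n) (fun m => m =? tau n) * (2 * 2 ^ n) <= 2 ^ n) by nia.
  apply H. intros Y HY. apply Nat.eqb_eq in HY. apply NNPP. intros HU. apply Hno. eauto.
Qed.

Theorem theorem4p1 :
  exists (A : cantor -> Prop) (W : nat -> cantor -> Prop),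
    eff_measurable A /\ universal_ML_test W /\ ~ layerwise_decidable W A.
Proof.
  destruct tau_accumulation as [X HX].
  assert (HX1 : ~ utest 1 X).
  (* Some [tau s'] with [s' >= s] shares the prefix of [X] that was enumerated at stage [s], so
     [tau s'] would belong to stage [s']. [Nat.testbit] turns [tau s'] into a point. *)
  { intros [s Hs]. destruct (HX s s) as (s' & Hs' & E). rewrite <- restr_testbit in E.
    rewrite <- E in Hs. apply (ustage_mono _ _ _ s') in Hs; auto.
    destruct (tau_spec s') as [Hlt Hf]. rewrite restr_testbit, Nat.mod_small in Hs by auto.
    congruence. }
  assert (exists M, ~ tau_union M X) as [M HM].
  (* Otherwise [X] lies in every level of the test of tails and, by universality, in [utest 1]. *)
  { apply NNPP. intros Hno. apply HX1. apply (utest_universal _ tau_union_ML_test).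
    intros j. apply NNPP. intros H. apply Hno. eauto. }
  exists (tau_union M), (wtest M).
  split; [apply tau_union_eff_measurable|]. split; [apply wtest_universal|].
  (* The contradiction arises for the complement: off level 0 it agrees with the open set [U 0]. *)
  intros [_ (U & [HUo _] & HU)].
  assert (HA : forall n, M <= n -> restr X n <> tau n)
    by (intros n Hn E; apply HM, tau_union_spec; eauto).
  assert (HUX : U 0 X).
  { apply HU; auto. intros HW. apply wtest_0_spec in HW as [(n & s & _ & [Hn E] & _)|(s & _ & Hs)].
    - now apply (HA n).
    - apply HX1. now exists s. }
  destruct (HUo 0 X HUX) as (t & Ht & HtU). set (l := length t) in *.
  destruct (HX l (max M l)) as (s & Hs & E).
  destruct (tau_spec s) as [Hlt _].
  (* The cylinder of [tau s] may lie inside an earlier one. Level 0 follows the first of them, so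
     [tau s] is replaced by its first hit [tau n]. *)
  destruct (least_ex (S s) (fun n => hit M n (tau s))) as [Hns Hn].
  { exists s. split; auto. apply hit_spec. rewrite Nat.mod_small; auto. lia. }
  pose proof (least_min (S s) (fun n => hit M n (tau s))) as Hmin.
  set (n := least _ _) in *. clearbody n. apply hit_spec in Hn as [HMn Hn].
  assert (Hln : l <= n).
  (* On its first [l] bits [tau s] agrees with [X], which has no hit. Hence [tau n] is long enough
     to stay inside the neighbourhood of [X]. *)
  { destruct (le_lt_dec l n) as [|Hl]; auto. exfalso. apply (HA n HMn).
    rewrite <- Hn, <- (mod_pow_mod n l), E, restr_mod by lia. reflexivity. }
  destruct (tau_cylinder_not_covered n) as (Y & HY & HYU).
  assert (HYA : tau_union M Y) by (apply tau_union_spec; eauto).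
  revert HYA. apply (HU 0 Y).
  - intros HW. apply wtest_0_spec in HW
      as [(n' & s' & Hs' & [HM' E'] & Hfirst & Hu)|(s' & Hnone & Hu)].
    (* The first hit of [Y] is [n], so [n'] must equal [n], and there [Y] was chosen outside
       [utest (S n)]. *)
    + destruct (lt_eq_lt_dec n n') as [[Hl|Hl]|Hl].
      * now apply (Hfirst n Hl HMn).
      * subst n'. apply HYU. now exists s'.
      * specialize (Hmin n' Hl). cbv beta in Hmin.
        rewrite (proj2 (hit_spec M n' _)) in Hmin; [discriminate|]. split; auto.
        rewrite <- (mod_pow_mod n' n), Hn, <- HY, restr_mod by lia. exact E'.
    (* From stage [n] on the hit is visible; an enumeration before stage [n] would put [tau n] into
       stage [n] of [utest 1]. *)
    + destruct (le_lt_dec n s') as [Hl|Hl]; [now apply (Hnone n)|].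
      apply (ustage_mono _ _ _ n) in Hu; [|lia]. rewrite HY in Hu.
      destruct (tau_spec n). congruence.
  - apply HtU, cyl_restr. fold l. rewrite <- (restr_mod Y l n), HY, <- Hn, mod_pow_mod, E by lia.
    now apply cyl_restr.
Qed.
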